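(* Let $K=2^m$ with $m\ge2$, let $L\in\mathbb{N}$, and let $a(t)\in\mathbb{R}^{K-1}$ evolve according to $$\frac{da_i}{dt}=\frac{1}{D}b_ia_i^{\frac{2L}{L+1}},\qquad b_i=\sum_{j=1}^{K-1}\Psi_{ij}e^{-(\Psi a)_j},\quad D=1+\sum_{j=1}^{K-1}e^{-(\Psi a)_j},$$ with $a_i(0)>0$ for all $i$. Then: (i) the direction $\hat a^*=\frac{1}{K-1}1_{K-1}$ is stable when $\|a\|_1>\frac{L-1}{L+1}(K-1)$ and unstable when $\|a\|_1<\frac{L-1}{L+1}(K-1)$; (ii) if $L>1$, there exists a direction $\hat a^{**}$ having some coordinates equal to zero (a lower-rank structure), and a threshold $\tau>0$, such that $\hat a^{**}$ is stable whenever $\|a\|_1>\tau$; (iii) if $L>1$, the quantity $D_{\mathrm{KL}}\big(\tfrac{1}{K-1}1_{K-1}\,\|\,\hat a(t)\big)$ is not monotonically decreasing along all trajectories, and there exist trajectories with strictly positive initialization along which it diverges to $+\infty$ as $t\to\infty$.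
   Context: Sylvester Hadamard matrices: $\Phi_1=(1)$, $\Phi_{2^m}=\begin{bmatrix}\Phi_{2^{m-1}}&\Phi_{2^{m-1}}\\ \Phi_{2^{m-1}}&-\Phi_{2^{m-1}}\end{bmatrix}$, with $\Phi=\Phi_K$. $\Psi\in\mathbb{R}^{(K-1)\times(K-1)}$ is obtained from $1_K1_K^T-\Phi$ by deleting its first row and column. $\|a\|_1=\sum_i|a_i|$ and $\hat a=a/\|a\|_1$ is the direction. A direction $\hat a^*$ is called stable (in a region of $\|a\|_1$) if, whenever $\hat a$ is sufficiently close to $\hat a^*$ (and $\|a\|_1$ lies in that region), the Euclidean distance from $\hat a$ to $\hat a^*$ decreases under the flow; unstable otherwise. $D_{\mathrm{KL}}(\frac{1}{K-1}1_{K-1}\|\hat a)=-\log(K-1)-\frac{1}{K-1}\sum_i\log\hat a_i$. *)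

(* Defs.v *)
From HB Require Import structures.
From mathcomp Require Import all_boot all_order all_algebra.
From mathcomp Require Import all_classical all_reals all_analysis.
Set Implicit Arguments. Unset Strict Implicit. Unset Printing Implicit Defensive.
Import Order.TTheory GRing.Theory Num.Theory.
Import numFieldNormedType.Exports.
Local Open Scope classical_set_scope.
Local Open Scope ring_scope.

Section Hadamard.
Variable R : realType.

(* Entries of the Sylvester Hadamard matrix Phi_{2^m}, nat-indexed (0-based),
   following the block recursion
   Phi_{2^(m+1)} = [[Phi_{2^m}, Phi_{2^m}], [Phi_{2^m}, -Phi_{2^m}]]. *)
Fixpoint sylv (m : nat) (i j : nat) : R :=
  match m with
  | 0 => 1
  | m'.+1 =>
      let h := (2 ^ m')%N in
      (if ((h <= i) && (h <= j))%N then -1 else 1) * sylv m' (i %% h)%N (j %% h)%N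
  end.

Definition Phi (m : nat) : 'M[R]_(2 ^ m)%N := \matrix_(i, j) sylv m i j.

(* Psi : (1 1^T - Phi) with its first row and first column deleted;
   index i : 'I_(K-1) of Psi corresponds to row i+1 of Phi. *)
Definition Psi (m : nat) : 'M[R]_((2 ^ m).-1)%N :=
  \matrix_(i, j) (1 - sylv m i.+1 j.+1).

Let n m := ((2 ^ m).-1)%N.

Definition Psia (m : nat) (a : 'I_(n m) -> R) (j : 'I_(n m)) : R :=
  \sum_k Psi m j k * a k.

Definition bcoef (m : nat) (a : 'I_(n m) -> R) (i : 'I_(n m)) : R :=
  \sum_j Psi m i j * expR (- Psia a j).

Definition Dden (m : nat) (a : 'I_(n m) -> R) : R :=
  1 + \sum_j expR (- Psia a j).

Definition field (m L : nat) (a : 'I_(n m) -> R) (i : 'I_(n m)) : R :=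
  (Dden a)^-1 * bcoef a i * (a i `^ ((2 * L)%:R / (L.+1)%:R)).

Definition norm1 (m : nat) (a : 'I_(n m) -> R) : R := \sum_i `|a i|.

Definition dir (m : nat) (a : 'I_(n m) -> R) : 'I_(n m) -> R :=
  fun i => a i / norm1 a.

Definition edist (m : nat) (u v : 'I_(n m) -> R) : R :=
  Num.sqrt (\sum_i (u i - v i) ^+ 2).

Definition unif (m : nat) : 'I_(n m) -> R := fun _ => ((n m)%:R)^-1.

Definition dist_to (m : nat) (dstar : 'I_(n m) -> R) (a : 'I_(n m) -> R) : R :=
  edist (dir a) dstar.

(* The distance from \hat a to dstar decreases under the flow at the state a:
   its time derivative along the vector field, i.e. d/dh at h = 0 of
   dist(a + h * field(a)), exists and is negative. *)
Definition decreases_at (m L : nat) (dstar a : 'I_(n m) -> R) : Prop :=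
  let g := fun h : R => dist_to dstar (fun i => a i + h * field L a i) in
  derivable g 0 1 /\ derive1 g 0 < 0.

(* dstar is stable at the l1-norm level s: for all states a (with positive
   coordinates, the state space of the flow) with ||a||_1 = s and \hat a
   sufficiently close to (but different from) dstar, the distance decreases. *)
Definition stable_at (m L : nat) (dstar : 'I_(n m) -> R) (s : R) : Prop :=
  exists2 delta : R, 0 < delta &
    forall a : 'I_(n m) -> R, (forall i, 0 < a i) -> norm1 a = s ->
      0 < dist_to dstar a < delta -> decreases_at L dstar a.

Definition unstable_at (m L : nat) (dstar : 'I_(n m) -> R) (s : R) : Prop :=
  ~ stable_at L dstar s.

Definition trajectory (m L : nat) (x : R -> 'I_(n m) -> R) : Prop :=
  (forall i, 0 < x 0 i) /\
  (forall t : R, 0 < t -> forall i,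
      derivable (fun s => x s i) t 1 /\
      derive1 (fun s => x s i) t = field L (x t) i) /\
  (forall i, (fun s => x s i) @ 0^'+ --> x 0 i).

Definition KLunif (m : nat) (a : 'I_(n m) -> R) : R :=
  - ln ((n m)%:R) - ((n m)%:R)^-1 * \sum_i ln (dir a i).

End Hadamard.

Arguments unif {R} m _.
Arguments stable_at {R} m L dstar s.
Arguments unstable_at {R} m L dstar s.
Arguments trajectory {R} m L x.
Arguments KLunif {R} m a.

(* Main.v *)
(* On the state space the quantity whose sign decides the derivative of the
   distance to a direction d is
     sum_i (ahat_i - d_i) (V_i - ahat_i sum_k V_k),   V = field.

   (i) Orthogonality of the Sylvester matrix gives Psi^2 = K (I + J), J being the
   all-ones matrix.  Hence, for ahat = 1/n + e with sum e = 0, the field is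
   proportional to 1 + (pn - s) e + O(|e|^2), p = 2L/(L+1), and the quantity above
   is a positive multiple of ((p-1) n - s) |e|^2 + O(|e|^3).

   (ii) Every vertex of the simplex is stable at every norm level: the small
   coordinates grow like a_i^p with p > 1, hence more slowly than a_i times the
   growth rate of the norm.

   (iii) On the invariant plane where one coordinate equals v and all others equal
   u, the derivative of v^(1-p) - 2 u^(1-p) is nonnegative.  If this quantity starts
   positive then v stays bounded, while u tends to infinity because its rate is
   bounded below wherever u is bounded.  So one coordinate of the direction tends
   to 0 and the divergence tends to infinity.  Global existence comes from Picard
   iteration, as the field on the plane is bounded and Lipschitz. *)
Require Import Defs.
From HB Require Import structures.
From mathcomp Require Import all_boot all_order all_algebra.
From mathcomp Require Import all_classical all_reals all_analysis.
From mathcomp Require Import ring lra.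
Import Order.TTheory GRing.Theory Num.Theory.
Import numFieldNormedType.Exports.
Local Open Scope classical_set_scope.
Local Open Scope ring_scope.

Set Implicit Arguments.
Unset Strict Implicit.
Unset Printing Implicit Defensive.

(** * Sylvester matrices *)

Lemma sylv_pm1 (R : realType) m i j : sylv R m i j = 1 \/ sylv R m i j = -1.
Proof.
elim: m i j => [|m IH] i j /=; first by left.
case: ifP => _; rewrite ?mul1r ?mulN1r //.
by case: (IH (i %% 2 ^ m)%N (j %% 2 ^ m)%N) => ->; [right|left]; rewrite ?opprK.
Qed.

Lemma sylvC (R : realType) m i j : sylv R m i j = sylv R m j i.
Proof. by elim: m i j => //= m IH i j; rewrite IH andbC. Qed.

Lemma sylv0 (R : realType) m j : sylv R m 0 j = 1.
Proof.
elim: m j => //= m IH j.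
by rewrite mod0n IH mulr1 leqNgt expn_gt0.
Qed.

(** Induction over the block recursion: the columns split into two halves, and the second half
    repeats the first multiplied by the signs [sg i * sg k]. Rows in the same half double the sum,
    rows in different halves cancel. *)
Lemma sylv_orthogonal (R : realType) m i k : (i < 2 ^ m)%N -> (k < 2 ^ m)%N ->
  \sum_(0 <= j < 2 ^ m) sylv R m i j * sylv R m k j = (2 ^ m)%:R *+ (i == k).
Proof.
elim: m i k => [|m IH] i k.
  rewrite expn0 !ltnS !leqn0 => /eqP-> /eqP->.
  by rewrite big_nat1 /= mulr1.
move=> ilt klt; set h := (2 ^ m)%N.
have h0 : (0 < h)%N by rewrite expn_gt0.
have hh : (2 ^ m.+1 = h + h)%N by rewrite expnS mul2n addnn.
pose sg (x : nat) : R := if (h <= x)%N then -1 else 1.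
have sum_half : \sum_(0 <= j < h) sylv R m (i %% h) j * sylv R m (k %% h) j
    = h%:R *+ (i %% h == k %% h)%N by rewrite IH // ltn_mod.
have shift_half (F : nat -> R) :
    \sum_(h <= j < h + h) F j = \sum_(0 <= j < h) F (j + h)%N.
  by rewrite -{1}[h]add0n big_addn addnK.
rewrite hh (@big_cat_nat _ _ _ h) ?leq_addr //= shift_half.
rewrite -/h [X in X + _](eq_big_nat _ _
    (F2 := fun j => sylv R m (i %% h) j * sylv R m (k %% h) j)); last first.
  move=> j /andP[_ jh]; rewrite (leqNgt h j) jh /= !andbF !mul1r.
  by rewrite (modn_small jh).
rewrite [X in _ + X](eq_big_nat _ _ (F2 := fun j =>
    sg i * sg k * (sylv R m (i %% h) j * sylv R m (k %% h) j))); last first.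
  move=> j /andP[_ jh]; rewrite leq_addl !andbT /= modnDr (modn_small jh).
  by rewrite -/(sg i) -/(sg k); ring.
rewrite -big_distrr /= sum_half.
have modE x : (x < h + h)%N -> (x %% h = if (h <= x)%N then x - h else x)%N.
  move=> xlt; case: leqP => xh; last exact: modn_small.
  by rewrite -{1}(subnK xh) modnDr modn_small // ltn_subLR.
rewrite hh in ilt klt.
rewrite (modE _ ilt) (modE _ klt) /sg; case: leqP => hi; case: leqP => hk.
- rewrite eqn_sub2rE // mulrNN !mul1r natrD mulrnDl //.
- have -> : (i == k) = false by apply/negbTE; rewrite neq_ltn (leq_trans hk hi) orbT.
  by rewrite mulN1r mulNr mul1r subrr.
- have -> : (i == k) = false by apply/negbTE; rewrite neq_ltn (leq_trans hi hk).
  by rewrite mul1r mulN1r subrr.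
- by rewrite !mul1r natrD mulrnDl.
Qed.

Section PsiFacts.
Variables (R : realType) (m : nat).
Local Notation n := (2 ^ m).-1.
Local Notation K := ((2 ^ m)%:R : R).
Local Notation Psi := (@Psi R m).

Lemma pred_pow2K : n.+1 = (2 ^ m)%N.
Proof. by rewrite prednK // expn_gt0. Qed.

Lemma natr_pred_pow2 : n%:R = K - 1 :> R.
Proof. by rewrite -pred_pow2K -natr1 addrK. Qed.

Lemma sum_sylv_tail (f : nat -> R) :
  \sum_(j < n) f j.+1 = \sum_(0 <= j < 2 ^ m) f j - f 0%N.
Proof.
rewrite -pred_pow2K big_nat_recl // addrC addKr.
by rewrite big_mkord.
Qed.

Lemma Psi_sym i j : Psi i j = Psi j i.
Proof. by rewrite !mxE sylvC. Qed.

Lemma Psi_02 i j : Psi i j = 0 \/ Psi i j = 2.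
Proof.
by rewrite !mxE; case: (sylv_pm1 R m i.+1 j.+1) => ->; [left|right]; rewrite ?subrr ?opprK.
Qed.

Lemma Psi_ge0 i j : 0 <= Psi i j.
Proof. by case: (Psi_02 i j) => ->. Qed.

Lemma Psi_le2 i j : Psi i j <= 2.
Proof. by case: (Psi_02 i j) => ->. Qed.

Lemma ord_lt_pow2 (i : 'I_n) : (i.+1 < 2 ^ m)%N.
Proof. by apply: leq_trans (_ : n.+1 <= _)%N; rewrite ?ltnS ?pred_pow2K. Qed.

Lemma sum_sylv (i : 'I_n) : \sum_(0 <= j < 2 ^ m) sylv R m i.+1 j = 0.
Proof.
have := sylv_orthogonal R (ord_lt_pow2 i) (expn_gt0 2 m).
rewrite mulr0n => orth0; rewrite -[RHS]orth0; apply: eq_big_nat => j _.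
by rewrite sylv0 mulr1.
Qed.

(** Rows other than row 0 are orthogonal to the all-ones row, so only the ones contribute; the
    deleted entry is zero. *)
Lemma Psi_row_sum i : \sum_j Psi i j = K.
Proof.
under eq_bigr do rewrite mxE.
rewrite (sum_sylv_tail (fun j => 1 - sylv R m i.+1 j)).
rewrite sumrB sum_sylv sylvC sylv0 !subrr subr0 subr0.
by rewrite big_const_nat subn0 iter_addr_0.
Qed.

(** Expanding [(1 - x) * (1 - y)], the linear sums vanish and orthogonality evaluates the product
    term. *)
Lemma Psi_sqr i k : \sum_j Psi i j * Psi j k = K * (1 + (i == k)%:R).
Proof.
under eq_bigr do rewrite [Psi _ k]Psi_sym !mxE.
rewrite (sum_sylv_tail (fun j => (1 - sylv R m i.+1 j) * (1 - sylv R m k.+1 j))).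
rewrite [sylv R m i.+1 0]sylvC sylv0 subrr mul0r subr0.
rewrite (eq_bigr (fun j => 1 - sylv R m i.+1 j - sylv R m k.+1 j +
   sylv R m i.+1 j * sylv R m k.+1 j)); last by move=> j _; ring.
rewrite big_split /= !sumrB !sum_sylv !subr0 sylv_orthogonal ?ord_lt_pow2 //.
rewrite big_const_nat subn0 iter_addr_0 eqSS mulrDr mulr1 mulr_natr.
by [].
Qed.

Lemma Psi_sqr_vec (e : 'I_n -> R) i :
  \sum_j Psi i j * (\sum_k Psi j k * e k) = K * e i + K * \sum_k e k.
Proof.
under eq_bigr do rewrite mulr_sumr.
rewrite exchange_big /=.
rewrite (eq_bigr (fun k => K * e k + K * ((i == k)%:R * e k))); last first.
  move=> k _; under eq_bigr do rewrite mulrA.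
  by rewrite -mulr_suml Psi_sqr; ring.
rewrite big_split /= -!mulr_sumr addrC; congr (_ * _ + _).
rewrite (bigD1 i) //= eqxx mul1r big1 ?addr0 // => k.
by rewrite eq_sym => /negbTE->; rewrite mul0r.
Qed.

End PsiFacts.

(** * Derivative of the distance to a direction *)

Lemma is_derive1_affine (R : realType) (a b x : R) :
  is_derive x 1 (fun h : R => a + h * b) b.
Proof.
have H : is_derive x 1 (cst a + (id * cst b) : R -> R) (0 + (x *: 0 + b *: 1)).
  by apply: is_deriveD.
apply: is_derive_eq H _.
by rewrite scaler0 !add0r /GRing.scale /= mulr1.
Qed.

Lemma is_derive1_sum (R : realType) (n : nat) (f : 'I_n -> R -> R)
    (df : 'I_n -> R) (x : R) :
  (forall i, is_derive x 1 (f i) (df i)) ->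
  is_derive x 1 (fun h => \sum_i f i h) (\sum_i df i).
Proof.
move=> H; have := is_derive_sum H; congr (is_derive _ _ _ _).
by apply/funext => h; rewrite fct_sumE.
Qed.

Section DistanceDerivative.
Variables (R : realType) (m : nat).
Local Notation n := (2 ^ m).-1.
Implicit Types a d V : 'I_n -> R.

Lemma sum_dir a : 0 < norm1 a -> (forall i, 0 < a i) -> \sum_i dir a i = 1.
Proof.
move=> s0 a0; rewrite -mulr_suml -(@divff _ (norm1 a)) ?gt_eqF //.
by congr (_ / _); apply: eq_bigr => i _; rewrite gtr0_norm.
Qed.

(** For small [h] the coordinates stay positive, so the l1-norm is affine in [h] and the direction
    is a smooth quotient. A nonzero distance makes the square root differentiable. *)
Lemma is_derive_dist_to d a V : (forall i, 0 < a i) -> 0 < norm1 a ->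
  0 < dist_to d a ->
  is_derive (0 : R) 1 (fun h : R => dist_to d (fun i => a i + h * V i))
    ((norm1 a * dist_to d a)^-1 *
       \sum_i (dir a i - d i) * (V i - dir a i * \sum_k V k)).
Proof.
move=> a0 s0 dist0; set s := norm1 a; set T := \sum_k V k.
have norm1E h : (forall i, 0 < a i + h * V i) ->
    norm1 (fun i => a i + h * V i) = s + h * T.
  move=> pos; rewrite /norm1 /s /norm1 /T mulr_sumr -big_split /=.
  by apply: eq_bigr => i _; rewrite gtr0_norm // gtr0_norm.
pose q i (h : R) := (a i + h * V i) * (s + h * T)^-1 - d i.
have dq i : is_derive (0 : R) 1 (q i) (s^-1 * (V i - dir a i * T)).
  have s00 : s + 0 * T != 0 by rewrite mul0r addr0 gt_eqF.
  have H := is_deriveB (is_deriveM (is_derive1_affine (a i) (V i) 0)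
    (@is_deriveV _ (fun h => s + h * T) 0 T 1 s00 (is_derive1_affine s T 0))) (is_derive_cst (d i) (0 : R) 1).
  apply: is_derive_eq H _.
  rewrite /GRing.scale /= !mul0r !addr0 subr0 /dir -/s.
  have : s != 0 by rewrite gt_eqF.
  by move=> ?; field.
pose Q (h : R) := \sum_i q i h ^+ 2.
have dQ : is_derive (0 : R) 1 Q
    (\sum_i (2 * q i 0) * (s^-1 * (V i - dir a i * T))).
  apply: is_derive1_sum => i.
  exact: (is_deriveX 2 (dq i)).
have q0 i : q i 0 = dir a i - d i by rewrite /q !mul0r !addr0.
have Q0 : Num.sqrt (Q 0) = dist_to d a.
  by congr Num.sqrt; apply: eq_bigr => i _; rewrite q0.
have Q0_gt0 : 0 < Q 0 by rewrite -sqrtr_gt0 Q0.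
have dsqrt := is_derive1_comp (is_derive1_sqrt Q0_gt0) dQ.
apply: (@near_eq_is_derive _ _ _ (Num.sqrt \o Q)).
  have pos i : \forall h \near (0 : R), 0 < a i + h * V i.
    have : (fun h => a i + h * V i) @ (0 : R) --> a i + 0 * V i.
      apply: cvgD; first exact: cvg_cst.
      by apply: cvgM; [exact: cvg_id|exact: cvg_cst].
    by rewrite mul0r addr0 => /cvgr_gt; apply.
  near=> h => /=.
  have hpos : forall i, 0 < a i + h * V i by near: h; exact: filter_forall.
  rewrite /dist_to /Defs.edist; congr Num.sqrt; apply: eq_bigr => i _.
  by rewrite /q /dir norm1E.
apply: is_derive_eq dsqrt _.
rewrite Q0 !mulr_sumr; apply: eq_bigr => i _; rewrite q0.
have : s != 0 by rewrite gt_eqF.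
have : dist_to d a != 0 by rewrite gt_eqF.
by move=> ? ?; field; apply/andP.
Unshelve. all: by end_near. Qed.

(** The derivative of the distance to [d] along [V], up to a positive factor. *)
Definition radial_rate d a V : R :=
  \sum_i (dir a i - d i) * (V i - dir a i * \sum_k V k).

Lemma decreases_at_rate L d a : (forall i, 0 < a i) -> 0 < norm1 a ->
  0 < dist_to d a ->
  decreases_at L d a <-> radial_rate d a (field L a) < 0.
Proof.
move=> a0 s0 dist0; have [dg g'] := is_derive_dist_to (field L a) a0 s0 dist0.
have c0 : 0 < (norm1 a * dist_to d a)^-1 by rewrite invr_gt0 mulr_gt0.
rewrite /decreases_at derive1E g' -/(radial_rate d a (field L a)).
rewrite pmulr_rlt0 //; split; first by case.
by [].
Qed.

End DistanceDerivative.

(** * Expansion at the uniform direction *)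

Lemma expR_le_inv (R : realType) (y : R) : y < 1 -> expR y <= (1 - y)^-1.
Proof.
move=> y1; have y1' : 0 < 1 - y by rewrite subr_gt0.
rewrite -[expR y]invrK -expRN lef_pV2 ?posrE ?expR_gt0 //.
exact: expR_ge1Dx.
Qed.

(** The lower bound is [1 + y <= expR y]; the upper one compares [(1 - y)^-1] with
    [1 + y + 2 * y ^+ 2]. *)
Lemma expR_taylor1 (R : realType) (y : R) : `|y| <= 1 / 2 ->
  `|expR y - (1 + y)| <= 2 * y ^+ 2.
Proof.
move=> /ler_normlP[yl yr]; have /expR_le_inv : y < 1 by lra.
have := expR_ge1Dx y => lo hi; rewrite ger0_norm ?subr_ge0 //.
rewrite lerBlDr; apply: le_trans hi _.
have y1 : 0 < 1 - y by lra.
rewrite -div1r ler_pdivrMr //.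
have := sqr_ge0 y; rewrite expr2; nra.
Qed.

(** The lower bound comes from the upper bound for the logarithm, applied to the inverse of
    [1 + z]. *)
Lemma ln_taylor1 (R : realType) (z : R) : `|z| <= 1 / 2 ->
  `|ln (1 + z) - z| <= 2 * z ^+ 2.
Proof.
move=> /ler_normlP[zl zr]; have z1 : 0 < 1 + z by lra.
have hi : ln (1 + z) <= z by apply: le_ln1Dx; lra.
have lo : - ln (1 + z) <= (1 + z)^-1 - 1.
  rewrite -lnV ?posrE // -{1}[(1 + z)^-1](subrKC 1).
  have : 0 < (1 + z)^-1 by rewrite invr_gt0.
  by move=> ?; apply: le_ln1Dx; lra.
have inv_le : (1 + z)^-1 <= 1 - z + 2 * z ^+ 2.
  rewrite -div1r ler_pdivrMr //.
  have := sqr_ge0 z; rewrite expr2; nra.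
by rewrite ler0_norm; lra.
Qed.

Section Uniform.
Variables (R : realType) (m L : nat).
Hypothesis m2 : (2 <= m)%N.
Local Notation n := (2 ^ m).-1.
Local Notation N := (n%:R : R).
Local Notation K := ((2 ^ m)%:R : R).
Implicit Types (a e : 'I_n -> R) (s d : R).

Lemma pred_pow2_ge3 : (3 <= n)%N.
Proof. by rewrite -ltnS pred_pow2K //; exact: (@leq_pexp2l 2 2 m). Qed.

Lemma natr_pred_pow2_ge3 : 3 <= N.
Proof. by rewrite (ler_nat R 3) pred_pow2_ge3. Qed.

Lemma Dden_gt0 a : 0 < Dden a.
Proof. by rewrite ltr_wpDr // sumr_ge0 // => j _; exact: expR_ge0. Qed.

Lemma norm_le_edist a e i : `|a i - e i| <= Defs.edist a e.
Proof.
rewrite /Defs.edist -sqrtr_sqr ler_wsqrtr // (bigD1 i) //= lerDl.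
by rewrite sumr_ge0 // => j _; exact: sqr_ge0.
Qed.

(** The constant part of the state contributes the row sum of [Psi], which factors out. Writing the
    power as an exponential leaves one exponential per summand, ready for a Taylor estimate. *)
Lemma bcoef_powR_uniform (p : R) s e i : 0 < s -> \sum_i e i = 0 -> 0 < N^-1 + e i ->
  bcoef (fun i => s * (N^-1 + e i)) i * (s * (N^-1 + e i)) `^ p =
  (s / N) `^ p * expR (- (s / N * K)) *
  \sum_j Psi R m i j *
    expR (- (s * \sum_k Psi R m j k * e k) + p * ln (1 + N * e i)).
Proof.
move=> s0 se ei; have N0 : 0 < N by apply: lt_le_trans natr_pred_pow2_ge3; lra.
have -> : s * (N^-1 + e i) = s / N * (1 + N * e i).
  by field; rewrite gt_eqF.
have q0 : 0 < 1 + N * e i.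
  by rewrite -(pmulr_rgt0 _ N0) in ei; rewrite mulrDr divff ?gt_eqF in ei.
rewrite powRM ?divr_ge0 ?ltW // /bcoef [LHS]mulrC -[LHS]mulrA -[RHS]mulrA.
congr (_ * _).
rewrite !mulr_sumr; apply: eq_bigr => j _.
have -> : Psia (fun i => s * (N^-1 + e i)) j =
    s / N * K + s * \sum_k Psi R m j k * e k.
  rewrite /Psia -(Psi_row_sum R j) !mulr_sumr -big_split /=.
  by apply: eq_bigr => k _; field; rewrite gt_eqF.
rewrite {1}/powR gt_eqF // opprD !expRD; ring.
Qed.

(** Each exponent is replaced by its part linear in [e]; the linearized sum is evaluated by the row
    sums and by [Psi_sqr_vec], where the sum of [e] vanishes. The constant [M] is uniform in [e]. *)
Lemma field_uniform_expansion (p : R) s : 0 <= p -> 0 < s ->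
  exists2 M : R, 0 < M & forall (e : 'I_n -> R) d, d <= M^-1 ->
    \sum_i e i = 0 -> (forall i, `|e i| <= d) ->
    forall i, 0 < N^-1 + e i ->
    `|bcoef (fun i => s * (N^-1 + e i)) i * (s * (N^-1 + e i)) `^ p -
      (s / N) `^ p * expR (- (s / N * K)) * K * (1 + (p * N - s) * e i)|
     <= (s / N) `^ p * expR (- (s / N * K)) * K * (M * d ^+ 2).
Proof.
move=> p0 s0; have N3 := natr_pred_pow2_ge3.
(* [A * d] bounds the exponents; the summand [2 * N] also forces [N * d <= 1 / 2]. The three terms
   of the final constant serve, in order, [A * d <= 1 / 2], the exponential remainder and the
   logarithmic one. *)
pose A := 2 * N * (s + p) + 2 * N.
have A0 : 0 < A.
  by rewrite ltr_wpDl ?mulr_gt0 ?(lt_le_trans _ N3) // !mulr_ge0 // addr_ge0 // ltW.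
have M0 : 0 < 2 * A + 2 * A ^+ 2 + 2 * p * N ^+ 2.
  apply: ltr_wpDr; first by rewrite mulr_ge0 ?sqr_ge0 // mulr_ge0.
  by apply: ltr_wpDr; rewrite ?mulr_gt0 // mulr_ge0 ?sqr_ge0.
exists (2 * A + 2 * A ^+ 2 + 2 * p * N ^+ 2) => //.
move=> e d dM se ed i ei.
have d0 : 0 <= d by apply: le_trans (ed i); exact: normr_ge0.
have Ad : A * d <= 1 / 2.
  move: dM; rewrite -div1r ler_pdivlMr // => dM.
  have h1 : 0 <= d * A ^+ 2 by rewrite mulr_ge0 ?sqr_ge0.
  have h2 : 0 <= d * (p * N ^+ 2) by rewrite !mulr_ge0 ?sqr_ge0.
  by clearbody A; lra.
rewrite bcoef_powR_uniform // -!mulrA -!mulrBr !normrM.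
rewrite (gtr0_norm (expR_gt0 _)) (ger0_norm (powR_ge0 _ _)).
rewrite !ler_wpM2l ?powR_ge0 ?expR_ge0 //.
pose lin j := - (s * \sum_k Psi R m j k * e k) + p * (N * e i).
have -> : K * (1 + (p * N - s) * e i) = \sum_j Psi R m i j * (1 + lin j).
  rewrite (eq_bigr (fun j => Psi R m i j * (1 + p * (N * e i)) -
    s * (Psi R m i j * \sum_k Psi R m j k * e k))); last first.
    by move=> j _; rewrite /lin; ring.
  rewrite sumrB -mulr_suml -mulr_sumr Psi_row_sum // Psi_sqr_vec // se.
  by ring.
rewrite -sumrB; apply: le_trans (ler_norm_sum _ _ _) _.
rewrite -(Psi_row_sum R i) mulr_suml; apply: ler_sum => j _.
rewrite -mulrBr normrM (ger0_norm (Psi_ge0 _ _ _)) ler_wpM2l ?Psi_ge0 //.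
set Pe := \sum_k _.
have Pe_le : `|Pe| <= 2 * N * d.
  apply: le_trans (ler_norm_sum _ _ _) _.
  have -> : 2 * N * d = \sum_(k < n) 2 * d.
    by rewrite sumr_const card_ord -mulr_natr; ring.
  apply: ler_sum => k _; rewrite normrM ger0_norm ?Psi_ge0 //.
  by apply: ler_pM => //; rewrite ?Psi_ge0 ?Psi_le2.
have Nei : `|N * e i| <= N * d by rewrite normrM ger0_norm // ler_wpM2l.
have Nd : N * d <= 1 / 2.
  have : 0 <= N * (s + p) * d by rewrite !mulr_ge0 // addr_ge0 // ltW.
  by rewrite /A in Ad; nra.
have lnE := ln_taylor1 (le_trans Nei Nd).
have Nei2 : (N * e i) ^+ 2 <= N ^+ 2 * d ^+ 2.
  rewrite -exprMn -[leLHS](real_normK (num_real _)) ler_sqr ?nnegrE //.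
  by rewrite mulr_ge0.
set y := _ + p * ln _.
have ylin : `|y - lin j| <= 2 * p * N ^+ 2 * d ^+ 2.
  have -> : y - lin j = p * (ln (1 + N * e i) - N * e i) by rewrite /y /lin -/Pe; ring.
  rewrite normrM (ger0_norm p0).
  have := ler_wpM2l p0 (le_trans lnE (ler_wpM2l (ler0n R 2) Nei2)).
  by move=> H; apply: le_trans H _; rewrite le_eqVlt; apply/orP; left; apply/eqP; ring.
have ln_le : `|ln (1 + N * e i)| <= 2 * (N * d).
  have -> : ln (1 + N * e i) = (ln (1 + N * e i) - N * e i) + N * e i by ring.
  apply: le_trans (ler_normD _ _) _.
  have : 0 <= N * d by rewrite mulr_ge0.
  have := le_trans lnE (ler_wpM2l (ler0n R 2) Nei2).
  by rewrite -exprMn expr2; nra.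
have yA : `|y| <= A * d.
  apply: le_trans (ler_normD _ _) _.
  rewrite normrN !normrM (gtr0_norm s0) (ger0_norm p0).
  have := ler_wpM2l p0 ln_le; have := ler_wpM2l (ltW s0) Pe_le.
  have : 0 <= N * d by rewrite mulr_ge0.
  by rewrite /A; nra.
have expE := expR_taylor1 (le_trans yA Ad).
have y2 : y ^+ 2 <= A ^+ 2 * d ^+ 2.
  rewrite -exprMn -[leLHS](real_normK (num_real _)) ler_sqr ?nnegrE //.
  by rewrite mulr_ge0 // ltW.
have -> : expR y - (1 + lin j) = (expR y - (1 + y)) + (y - lin j) by ring.
apply: le_trans (ler_normD _ _) _.
have : 0 <= A * d ^+ 2 by rewrite mulr_ge0 ?sqr_ge0 // ltW.
by nra.
Qed.

Local Notation p := ((2 * L)%:R / L.+1%:R : R).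

(** With [e] the deviation and [r] the relative error of the field, the rate is [c] times the sum of
    [(p * N - s - N) * d ^+ 2] and [\sum_i e i * r i - d ^+ 2 * \sum_i r i], the latter of order
    [d ^+ 3]. The factor [c] depends on [a] but is positive, so it leaves the sign alone. *)
Lemma radial_rate_uniform s : 0 < s ->
  exists M : R, exists2 delta : R, 0 < delta & forall a,
    (forall i, 0 < a i) -> norm1 a = s -> dist_to (unif m) a < delta ->
    exists2 c : R, 0 < c &
      `|radial_rate (unif m) a (field L a) -
        c * ((p - 1) * N - s) * dist_to (unif m) a ^+ 2|
      <= c * M * dist_to (unif m) a ^+ 3.
Proof.
move=> s0; have p0 : 0 <= p by rewrite divr_ge0.
have [M M0 HM] := field_uniform_expansion p0 s0.
exists (2 * N * M), (Num.min 1 M^-1).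
  by rewrite lt_min ltr01 invr_gt0.
move=> a a0 as_; set d := dist_to _ _; rewrite lt_min => /andP[d1 dM].
have N3 := natr_pred_pow2_ge3.
pose e i := dir a i - N^-1.
have ed i : `|e i| <= d by exact: (norm_le_edist (dir a) (unif m) i).
have d0 : 0 <= d by exact: sqrtr_ge0.
have d2 : d ^+ 2 = \sum_i e i ^+ 2.
  by rewrite /d /dist_to /Defs.edist sqr_sqrtr // sumr_ge0 // => i _; exact: sqr_ge0.
have se : \sum_i e i = 0.
  rewrite sumrB sum_dir ?as_ // sumr_const card_ord -[X in _ - X]mulr_natr.
  by rewrite mulVf ?subrr // gt_eqF //; lra.
have aE : a = fun i => s * (N^-1 + e i).
  apply/funext => i; rewrite /e /dir as_; field.
  by rewrite !gt_eqF //; lra.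
have de i : 0 < N^-1 + e i.
  by have := a0 i; rewrite aE pmulr_rgt0.
set C := (s / N) `^ p * expR (- (s / N * K)) * K.
have C0 : 0 < C.
  rewrite !mulr_gt0 ?expR_gt0 ?powR_gt0 ?divr_gt0 ?ltr0n ?expn_gt0 //.
  by apply: leq_trans pred_pow2_ge3.
have {HM} := fun i => HM e d (ltW dM) se ed i (de i); rewrite -/C -aE => HM.
pose r i := C^-1 * (bcoef a i * (s * (N^-1 + e i)) `^ p) -
  (1 + (p * N - s) * e i).
have rM i : `|r i| <= M * d ^+ 2.
  rewrite -(ler_pM2l C0) -{1}(gtr0_norm C0) -normrM /r mulrBr mulVKf ?gt_eqF //.
pose c := C / Dden a.
have c0 : 0 < c by rewrite divr_gt0 ?Dden_gt0.
exists c => //.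
have fE i : field L a i = c * (1 + (p * N - s) * e i + r i).
  have ai : a i = s * (N^-1 + e i) by rewrite aE.
  rewrite /field /r /c ai; field.
  by rewrite !gt_eqF ?Dden_gt0.
have sumf : \sum_i field L a i = c * (N + \sum_i r i).
  under eq_bigr do rewrite fE.
  rewrite -mulr_sumr !big_split /= -mulr_sumr se mulr0 addr0.
  by rewrite sumr_const card_ord.
have -> : radial_rate (unif m) a (field L a) =
    c * ((p * N - s - N) * d ^+ 2 + (\sum_i e i * r i - d ^+ 2 * \sum_i r i)).
  rewrite /radial_rate sumf.
  rewrite (eq_bigr (fun i => c * e i + c * (p * N - s - (N + \sum_i r i)) * e i ^+ 2
     + c * (e i * r i) - c * (N + \sum_i r i) * N^-1 * e i)); last first.
    move=> i _; rewrite fE; have -> : dir a i = N^-1 + e i by rewrite addrC subrK.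
    by rewrite /unif; ring.
  rewrite sumrB !big_split /= -!mulr_sumr se -d2; ring.
have -> : forall x y, c * ((p * N - s - N) * d ^+ 2 + (x - y)) -
    c * ((p - 1) * N - s) * d ^+ 2 = c * (x - y) by move=> x y; ring.
rewrite normrM (gtr0_norm c0) -mulrA ler_pM2l //.
apply: le_trans (ler_normB _ _) _.
have cN (x : R) : \sum_(i < n) x = N * x by rewrite sumr_const card_ord mulr_natl.
have h1 : `|\sum_i e i * r i| <= N * (M * d ^+ 3).
  apply: le_trans (ler_norm_sum _ _ _) _.
  rewrite -cN; apply: ler_sum => i _.
  by rewrite normrM exprS mulrCA ler_pM.
have h2 : `|d ^+ 2 * \sum_i r i| <= N * (M * d ^+ 4).
  rewrite normrM ger0_norm ?sqr_ge0 //.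
  have -> : N * (M * d ^+ 4) = d ^+ 2 * (N * (M * d ^+ 2)) by ring.
  rewrite ler_wpM2l ?sqr_ge0 //.
  apply: le_trans (ler_norm_sum _ _ _) _.
  by rewrite -cN; apply: ler_sum.
have h3 : N * (M * d ^+ 4) <= N * (M * d ^+ 3).
  rewrite ler_wpM2l // ler_wpM2l ?(ltW M0) // [d ^+ 4]exprS.
  by rewrite ler_piMl ?exprn_ge0 // ltW.
by lra.
Qed.

End Uniform.

(** * Stability and instability *)

Section Stability.
Variables (R : realType) (m L : nat).
Hypothesis m2 : (2 <= m)%N.
Local Notation n := (2 ^ m).-1.
Local Notation N := (n%:R : R).
Local Notation K := ((2 ^ m)%:R : R).
Local Notation p := ((2 * L)%:R / L.+1%:R : R).
Local Notation c := ((L%:R - 1) / (L%:R + 1) * N).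
Implicit Types (a : 'I_n -> R) (s : R).

Lemma exponent_sub1 : p - 1 = (L%:R - 1) / (L%:R + 1).
Proof.
rewrite -natr1 natrM; field.
by rewrite gt_eqF // ltr_wpDl.
Qed.

(** The quadratic term has the sign of [c - s] and dominates the cubic error once the distance is
    below [s - c] divided by |M| + 1; the added 1 allows for [M = 0]. *)
Lemma uniform_stable s : 0 < s -> c < s -> stable_at m L (unif m) s.
Proof.
move=> s0 cs; have [M [delta delta0 H]] := @radial_rate_uniform R m L m2 s s0.
have M1 : 0 < `|M| + 1 by rewrite ltr_wpDl.
exists (Num.min delta ((s - c) / (`|M| + 1))).
  by rewrite lt_min delta0 divr_gt0 // subr_gt0.
move=> a a0 as_ /andP[d0]; rewrite lt_min => /andP[ddelta].
rewrite ltr_pdivlMr // => dM.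
apply/decreases_at_rate; rewrite ?as_ //.
have [C C0] := H a a0 as_ ddelta; rewrite exponent_sub1.
set d := dist_to _ _ in d0 dM *; set rr := radial_rate _ _ _.
move=> /ler_normlP[_]; rewrite lerBlDr => /le_lt_trans; apply.
have -> : C * M * d ^+ 3 + C * (c - s) * d ^+ 2 =
  C * d ^+ 2 * (M * d - (s - c)) by ring.
rewrite pmulr_rlt0 ?mulr_gt0 ?exprn_gt0 // subr_lt0.
apply: le_lt_trans dM; rewrite mulrC ler_pM2l //.
by rewrite (le_trans (ler_norm M)) // lerDl.
Qed.

(** States moved by [r] and [- r] in two coordinates lie arbitrarily close to the uniform direction,
    and there the rate is positive. *)
Lemma uniform_unstable s : 0 < s -> s < c -> unstable_at m L (unif m) s.
Proof.
move=> s0 sc [delta' delta'0 stab].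
have [M [delta delta0 H]] := @radial_rate_uniform R m L m2 s s0.
have N3 := natr_pred_pow2_ge3 R m2; have N0 : 0 < N by lra.
have M1 : 0 < `|M| + 1 by rewrite ltr_wpDl.
(* The bounds in [rho] give, in order, validity of the expansion, the range of the assumed
   stability, positive coordinates, and a cubic error below the quadratic term. The distance will be
   [r] times the square root of 2, hence below [rho]. *)
pose rho := Num.min (Num.min delta delta') (Num.min N^-1 ((c - s) / (`|M| + 1))).
have rho0 : 0 < rho.
  by rewrite !lt_min delta0 delta'0 invr_gt0 N0 divr_gt0 ?subr_gt0.
pose r := rho / 4; have r0 : 0 < r by rewrite divr_gt0.
pose i0 : 'I_n := Ordinal (ltn_trans (ltn0Sn 1) (pred_pow2_ge3 m2)).
pose i1 : 'I_n := Ordinal (ltn_trans (ltnSn 1) (pred_pow2_ge3 m2)).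
pose e i : R := if i == i0 then r else if i == i1 then - r else 0.
have i10 : i1 != i0 by [].
have sum2 (f : 'I_n -> R) : (forall i, i != i0 -> i != i1 -> f i = 0) ->
    \sum_i f i = f i0 + f i1.
  move=> f0; rewrite (bigD1 i0) //= (bigD1 i1) //= big1 ?addr0 //.
  by move=> i /andP[]; exact: f0.
have e0 : e i0 = r by rewrite /e eqxx.
have e1 : e i1 = - r by rewrite /e eqxx (negbTE i10).
have ez i : i != i0 -> i != i1 -> e i = 0 by rewrite /e => /negbTE-> /negbTE->.
have se : \sum_i e i = 0 by rewrite sum2 // e0 e1 subrr.
have rhoN : rho <= N^-1 by rewrite !ge_min lexx !orbT.
pose a i := s * (N^-1 + e i).
have a0 i : 0 < a i.
  rewrite mulr_gt0 // /e; have : 0 < N^-1 by rewrite invr_gt0.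
  by case: eqP => _; [|case: eqP => _]; rewrite /r; lra.
have as_ : norm1 a = s.
  rewrite /norm1 (eq_bigr a); last by move=> i _; rewrite gtr0_norm.
  rewrite -mulr_sumr big_split /= se addr0 sumr_const card_ord.
  by rewrite -[_ *+ _]mulr_natr mulVf ?mulr1 // gt_eqF.
have dE i : dir a i - unif m i = e i.
  rewrite /dir as_ /a /unif; field.
  by rewrite !gt_eqF.
set d := dist_to (unif m) a.
have d2 : d ^+ 2 = 2 * r ^+ 2.
  rewrite /d /dist_to /Defs.edist sqr_sqrtr; last first.
    by rewrite sumr_ge0 // => i _; exact: sqr_ge0.
  under eq_bigr do rewrite dE.
  rewrite sum2; first by rewrite e0 e1; ring.
  by move=> i h0 h1; rewrite ez // expr0n.
have d_ge0 : 0 <= d by exact: sqrtr_ge0.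
have d0 : 0 < d.
  rewrite lt_neqAle d_ge0 andbT eq_sym; apply/eqP => dz.
  by move: d2; rewrite dz expr0n /= => /esym/eqP; rewrite gt_eqF // mulr_gt0 ?exprn_gt0.
have drho : d < rho.
  have : d ^+ 2 < rho ^+ 2 by rewrite d2 /r; nra.
  by rewrite ltr_sqr ?nnegrE // ltW.
have [dd dd' dM] : [/\ d < delta, d < delta' & d < (c - s) / (`|M| + 1)].
  by move: drho; rewrite !lt_min => /andP[/andP[-> ->] /andP[_ ->]].
have := stab a a0 as_; rewrite -/d d0 dd' => /(_ isT).
move/decreases_at_rate; rewrite as_ => /(_ a0 s0 d0).
have [C C0] := H a a0 as_ dd; rewrite exponent_sub1 -/d.
set rr := radial_rate _ _ _.
move=> /ler_normlP[+ _] rr0; apply/negP; rewrite -ltNge.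
rewrite opprB; apply: lt_trans (_ : C * (c - s) * d ^+ 2 < _); last first.
  by rewrite ltrDl oppr_gt0.
have -> : C * (c - s) * d ^+ 2 = C * d ^+ 2 * (c - s) by ring.
have -> : C * M * d ^+ 3 = C * d ^+ 2 * (M * d) by ring.
rewrite ltr_pM2l ?mulr_gt0 ?exprn_gt0 //.
move: dM; rewrite ltr_pdivlMr //; apply: le_lt_trans.
rewrite mulrC ler_pM2l //.
by rewrite (le_trans (ler_norm M)) // lerDl.
Qed.

(** * Stability of the vertices of the simplex *)

Lemma Psia_ge0 a j : (forall i, 0 < a i) -> 0 <= Psia a j.
Proof. by move=> a0; rewrite sumr_ge0 // => k _; rewrite mulr_ge0 ?Psi_ge0 // ltW. Qed.

Lemma bcoef_le a i : (forall i, 0 < a i) -> bcoef a i <= K.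
Proof.
move=> a0; rewrite -(Psi_row_sum R i); apply: ler_sum => j _.
by rewrite ler_piMr ?Psi_ge0 // expR_le1 oppr_le0 Psia_ge0.
Qed.

(** Entries of [Psi] are at most 2, so [Psia a j <= 2 * norm1 a]; the resulting bound depends on the
    state through its norm alone. *)
Lemma bcoef_ge a i : (forall i, 0 < a i) ->
  K * expR (- (2 * norm1 a)) <= bcoef a i.
Proof.
move=> a0; rewrite -(Psi_row_sum R i) mulr_suml; apply: ler_sum => j _.
rewrite ler_wpM2l ?Psi_ge0 // ler_expR lerN2 mulr_sumr.
by apply: ler_sum => k _; rewrite gtr0_norm // ler_wpM2r ?Psi_le2 // ltW.
Qed.

Lemma exponent_gt1 : (1 < L)%N -> 1 < p.
Proof.
move=> L1; rewrite ltr_pdivlMr // mul1r ltr_nat.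
by rewrite mul2n -addnn -addn1 ltn_add2l.
Qed.

(** Every coordinate [i] other than [i0] grows slower than [dir a i * T], which makes its term
    negative. The deviations [V i - dir a i * T] sum to zero, so the one at [i0] is nonnegative and
    meets the nonpositive factor [dir a i0 - 1]. *)
Lemma vertex_stable (i0 : 'I_n) s : (1 < L)%N -> 0 < s ->
  stable_at m L (fun i => (i == i0)%:R) s.
Proof.
(* [K * B] is a lower bound for the numerator of the field at [i0] once [dir a i0 >= 1 / 2]. The
   number [eta] below has power [p - 1] equal to [B / (2 * s)], where the 2 leaves room for a strict
   inequality. *)
move=> /exponent_gt1 p1 s0; pose B := expR (- (2 * s)) * (s / 2) `^ p.
have B0 : 0 < B by rewrite mulr_gt0 ?expR_gt0 // powR_gt0 // divr_gt0.
pose eta := (B / (2 * s)) `^ (p - 1)^-1.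
have eta0 : 0 < eta by rewrite powR_gt0 // divr_gt0 // mulr_gt0.
have p10 : 0 < p - 1 by rewrite subr_gt0.
exists (Num.min (1 / 2) (eta / s)).
  by rewrite lt_min divr_gt0 // divr_gt0.
move=> a a0 as_ /andP[d0]; rewrite lt_min => /andP[d_half d_eta].
apply/decreases_at_rate; rewrite ?as_ //.
set ds := fun i => _ in d0 d_half d_eta *.
set V := field L a; rewrite /radial_rate; set T := \sum_k V k.
have dist_ge i := norm_le_edist (dir a) ds i.
have dir_gt0 i : 0 < dir a i by rewrite /dir as_ divr_gt0.
have aE i : a i = s * dir a i.
  by rewrite /dir as_ mulrC divfK // gt_eqF.
have K0 : 0 < K by rewrite ltr0n expn_gt0.
have V_ge0 i : 0 <= V i.
  rewrite /V /field !mulr_ge0 ?powR_ge0 ?invr_ge0 ?ltW ?Dden_gt0 //.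
  apply: lt_le_trans (bcoef_ge _ a0).
  by rewrite mulr_gt0 ?expR_gt0.
have T_ge : (Dden a)^-1 * (K * B) <= T.
  apply: le_trans (_ : V i0 <= _); last first.
    by rewrite /T (bigD1 i0) //= lerDl sumr_ge0.
  rewrite /V /field -[leRHS]mulrA ler_wpM2l ?invr_ge0 ?(ltW (Dden_gt0 _)) // /B mulrA.
  apply: ler_pM; rewrite ?powR_ge0 ?mulr_ge0 ?expR_ge0 //.
    by rewrite -as_; exact: bcoef_ge.
  apply: ge0_ler_powR; rewrite ?nnegrE ?divr_ge0 ?(ltW s0) ?(ltW (a0 _)) //.
  rewrite aE ler_pM2l //.
  have := le_lt_trans (dist_ge i0) d_half.
  by rewrite /ds eqxx /= => /ltr_normlP[]; lra.
have V_lt i : i != i0 -> V i < dir a i * T.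
  move=> ii0; have dirE : dir a i < eta / s.
    have := le_lt_trans (dist_ge i) d_eta.
    by rewrite /ds (negbTE ii0) subr0 gtr0_norm.
  apply: lt_le_trans (ler_wpM2l (ltW (dir_gt0 i)) T_ge).
  rewrite /V /field mulrCA -mulrA ltr_pM2l ?invr_gt0 ?Dden_gt0 //.
  rewrite -(mulr_powRB1 (ltW (a0 i))) ?(lt_trans ltr01) //.
  apply: le_lt_trans (_ : K * (a i * (B / (2 * s))) < _).
    apply: ler_pM; rewrite ?mulr_ge0 ?powR_ge0 ?(ltW (a0 i)) ?bcoef_le //.
      by apply: le_trans (bcoef_ge _ a0); rewrite mulr_ge0 ?expR_ge0.
    rewrite ler_pM2l //.
    have -> : B / (2 * s) = eta `^ (p - 1).
      by rewrite /eta -powRrM mulVf ?powRr1 ?gt_eqF // ltW // divr_gt0 // mulr_gt0.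
    apply: ge0_ler_powR; rewrite ?nnegrE ?(ltW eta0) ?(ltW (a0 i)) ?(ltW p10) //.
    by move: dirE; rewrite ltr_pdivlMr // aE mulrC => /ltW.
  rewrite [ltRHS]mulrCA ltr_pM2l // aE.
  have -> : s * dir a i * (B / (2 * s)) = dir a i * B / 2.
    by field; rewrite gt_eqF.
  have : 0 < dir a i * B by rewrite mulr_gt0.
  by lra.
have neg i : i != i0 -> (dir a i - ds i) * (V i - dir a i * T) < 0.
  move=> ii0; rewrite /ds (negbTE ii0) subr0 pmulr_rlt0 // subr_lt0.
  exact: V_lt.
have [i1 i1E] : exists i1, i1 != i0.
  pose j0 : 'I_n := Ordinal (ltn_trans (ltn0Sn 1) (pred_pow2_ge3 m2)).
  pose j1 : 'I_n := Ordinal (ltn_trans (ltnSn 1) (pred_pow2_ge3 m2)).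
  by have [<-|] := eqVneq j0 i0; [exists j1|exists j0].
have dir1 : \sum_i dir a i = 1 by rewrite sum_dir ?as_.
rewrite (bigD1 i0) //= (bigD1 i1) //=.
have first_le0 : (dir a i0 - ds i0) * (V i0 - dir a i0 * T) <= 0.
  have : \sum_i (V i - dir a i * T) = 0.
    by rewrite sumrB -mulr_suml dir1 mul1r subrr.
  rewrite (bigD1 i0) //= => /eqP; rewrite addr_eq0 => /eqP ->.
  rewrite mulr_le0_ge0 //.
    rewrite /ds eqxx subr_le0 -dir1 (bigD1 i0) //= lerDl.
    by rewrite sumr_ge0 // => i _; exact: ltW.
  rewrite oppr_ge0 sumr_le0 // => i ii0.
  by rewrite subr_le0 ltW // V_lt.
have rest_le0 : \sum_(i | (i != i0) && (i != i1))
    (dir a i - ds i) * (V i - dir a i * T) <= 0.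
  by rewrite sumr_le0 // => i /andP[ii0 _]; exact/ltW/neg.
by have := neg i1 i1E; lra.
Qed.

End Stability.

(** * Picard iteration for bounded Lipschitz fields *)

Lemma lipschitz_continuous (R : realType) (B : R) (F : R -> R) :
  (forall s t, `|F s - F t| <= B * `|s - t|) -> continuous F.
Proof.
move=> H x; apply/cvgrPdist_lt => eps eps0.
have B1 : 0 < `|B| + 1 by rewrite ltr_wpDl.
exists (eps / (`|B| + 1)); first by rewrite /= divr_gt0.
move=> y /=; rewrite ltr_pdivlMr // => xy; apply: le_lt_trans (H _ _) _.
apply: le_lt_trans xy; rewrite mulrC ler_wpM2l //.
by rewrite (le_trans (ler_norm B)) // lerDl.
Qed.

Lemma is_derive1_continuous (R : realType) (F : R -> R) (x df : R) :
  is_derive x 1 F df -> {for x, continuous F}.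
Proof. by move=> [dF _]; exact/differentiable_continuous/derivable1_diffP. Qed.

(** Differentiability is asked for only inside the interval: solutions are differentiated for
    [t > 0] while the intervals may start at 0. *)
Lemma MVT_continuous (R : realType) (F dF : R -> R) (a b : R) :
  a < b -> {in `[a, b], continuous F} ->
  (forall x, a < x < b -> is_derive x 1 F (dF x)) ->
  exists2 x, a < x < b & F b - F a = dF x * (b - a).
Proof.
move=> ab cF H; have dF_itv x : x \in `]a, b[ -> is_derive x 1 F (dF x).
  by rewrite in_itv /= => /H.
have cF_itv : {within `[a, b], continuous F}.
  by apply: continuous_in_subspaceT => x; rewrite inE => /cF.
have [x] := MVT ab dF_itv cF_itv.
by rewrite in_itv /= => ? ?; exists x.
Qed.

(** [G + F] and [G - F] start nonnegative and have nonnegative derivatives. This stands in for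
    integral estimates. *)
Lemma norm_le_derive_le (R : realType) (F dF G dG : R -> R) :
  continuous F -> continuous G ->
  (forall t : R, 0 < t -> is_derive t 1 F (dF t)) ->
  (forall t : R, 0 < t -> is_derive t 1 G (dG t)) ->
  (forall t, 0 < t -> `|dF t| <= dG t) -> `|F 0| <= G 0 ->
  forall t, 0 <= t -> `|F t| <= G t.
Proof.
move=> cF cG HF HG Hle H0 t; rewrite le_eqVlt => /predU1P[<- //|t0].
move: H0 => /ler_normlP[H0l H0r]; apply/ler_normlP; split.
- have [|x|x /andP[x0 _]] := @MVT_continuous R (G + F) (fun x => dG x + dF x) 0 t t0.
  + by move=> x _; apply: cvgD; [exact: cG|exact: cF].
  + by move=> /andP[x0 _]; apply: is_deriveD; [exact: HG|exact: HF].
  have /ler_normlP[hl hr] := Hle x x0.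
  rewrite !fctE subr0 => E; have : 0 <= (dG x + dF x) * t.
    by rewrite mulr_ge0 ?(ltW t0) //; lra.
  by rewrite -E; lra.
- have [|x|x /andP[x0 _]] := @MVT_continuous R (G - F) (fun x => dG x - dF x) 0 t t0.
  + by move=> x _; apply: cvgB; [exact: cG|exact: cF].
  + by move=> /andP[x0 _]; apply: is_deriveB; [exact: HG|exact: HF].
  have /ler_normlP[hl hr] := Hle x x0.
  rewrite !fctE subr0 => E; have : 0 <= (dG x - dF x) * t.
    by rewrite mulr_ge0 ?(ltW t0) //; lra.
  by rewrite -E; lra.
Qed.

(** A criterion by values of [F] alone, hence one that survives pointwise limits. *)
Lemma is_derive1_quadratic (R : realType) (F : R -> R) (t v C delta : R) :
  0 < delta ->
  (forall h, `|h| < delta -> `|F (h + t) - F t - h * v| <= C * h ^+ 2) ->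
  is_derive t 1 F v.
Proof.
move=> delta0 H.
have cv : h^-1 *: ((F \o shift t) (h *: 1) - F t) @[h --> (0:R)^'] --> v.
  apply/cvgrPdist_le => eps eps0.
  have C1 : 0 < `|C| + 1 by rewrite ltr_wpDl.
  exists (Num.min delta (eps / (`|C| + 1))).
    by rewrite /= lt_min delta0 divr_gt0.
  move=> h /=; rewrite sub0r normrN lt_min => /andP[hd]; rewrite ltr_pdivlMr //.
  move=> heps h0; rewrite /GRing.scale /= mulr1.
  have -> : v - h^-1 * (F (h + t) - F t) = - (h^-1 * (F (h + t) - F t - h * v)).
    by field.
  rewrite normrN normrM normfV mulrC ler_pdivrMr ?normr_gt0 //.
  apply: le_trans (H h hd) _; rewrite -(real_normK (num_real h)) expr2 mulrA.
  rewrite ler_wpM2r //; apply/ltW; apply: le_lt_trans heps.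
  by rewrite mulrC ler_wpM2l // (le_trans (ler_norm C)) // lerDl.
apply: DeriveDef; first by apply/cvg_ex; exists v.
exact: cvg_lim cv.
Qed.

Section Primitive.
Variable R : realType.
Local Notation mu := (@lebesgue_measure R).

(** The base point -1 makes [t = 0] an interior point, so the derivative formula holds there too. *)
Definition primitive (g : R -> R) (t : R) : R :=
  (\int[mu]_(s in `[(-1)%R, t]) g s)%R.

Lemma is_derive_primitive (g : R -> R) (t : R) : continuous g -> -1 < t ->
  is_derive t 1 (primitive g) (g t).
Proof.
move=> cg t1; have t2 : t < t + 1 by rewrite ltrDl.
have [|] := @continuous_FTC1_closed R g (-1) t (t + 1) t2 _ t1 (cg t).
  apply: continuous_compact_integrable; first exact: segment_compact.
  exact: continuous_subspaceT.
by move=> dF F'; apply: DeriveDef => //; rewrite -derive1E.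
Qed.

End Primitive.

Section Picard.
Variables (R : realType) (I : finType) (f : (I -> R) -> I -> R) (B C : R).
Hypothesis f_bounded : forall x i, `|f x i| <= B.
Hypothesis f_lipschitz : forall x y i,
  `|f x i - f y i| <= C * \sum_k `|x k - y k|.
Variable x0 : I -> R.
Implicit Types y : R -> I -> R.

(** The integral from 0 is a difference of primitives; [Num.max t 0] freezes the curve at [x0] for
    negative times, so that it is Lipschitz on the whole line. *)
Definition picard_step y (t : R) (i : I) : R :=
  let g s := f (y s) i in
  x0 i + (primitive g (Num.max t 0) - primitive g 0).

Fixpoint picard_iter (k : nat) : R -> I -> R :=
  if k is k'.+1 then picard_step (picard_iter k') else fun _ => x0.

(** This class makes the integrand continuous and is preserved by [picard_step] since [f] is bounded
    by [B]. *)
Definition lipB y := forall i s t, `|y s i - y t i| <= B * `|s - t|.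

Lemma B_ge0 (i : I) : 0 <= B.
Proof. by apply: le_trans (f_bounded x0 i). Qed.

Lemma lipschitz_norm_le (x z : I -> R) i : `|f x i - f z i| <= `|C| * \sum_k `|x k - z k|.
Proof.
apply: le_trans (f_lipschitz x z i) _.
by rewrite ler_wpM2r ?ler_norm // sumr_ge0.
Qed.

Lemma lipB_comp y i : lipB y ->
  forall s t, `|f (y s) i - f (y t) i| <= `|C| * (#|I|%:R * B) * `|s - t|.
Proof.
move=> yB s t; apply: le_trans (lipschitz_norm_le _ _ _) _.
rewrite -mulrA ler_wpM2l // -mulrA mulr_natl -sumr_const.
by apply: ler_sum => k _; exact: yB.
Qed.

Lemma lipB_continuous y i : lipB y -> continuous (fun s => f (y s) i).
Proof. by move=> /lipB_comp H; exact: lipschitz_continuous (H i). Qed.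

Lemma picard_step0 y i : picard_step y 0 i = x0 i.
Proof. by rewrite /picard_step maxxx subrr addr0. Qed.

Lemma picard_step_lipB y : lipB y -> lipB (picard_step y).
Proof.
move=> yB i; have cg := @lipB_continuous y i yB.
set g := fun s => _ in cg.
have mono a b : 0 <= a -> a <= b ->
    `|primitive g b - primitive g a| <= B * (b - a).
  move=> a0; rewrite le_eqVlt => /predU1P[<-|ab]; first by rewrite !subrr normr0 mulr0.
  have dg s : a <= s -> is_derive s 1 (primitive g) (g s).
    by move=> a_s; apply: is_derive_primitive => //; lra.
  have [||x _ ->] := @MVT_continuous R (primitive g) g a b ab.
  - by move=> s; rewrite in_itv /= => /andP[/dg + _]; exact: is_derive1_continuous.
  - by move=> s /andP[/ltW /dg].
  by rewrite normrM (gtr0_norm (_ : 0 < b - a)) ?subr_gt0 // ler_pM2r ?subr_gt0 ?f_bounded.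
have mono' s t : s <= t ->
    `|picard_step y t i - picard_step y s i| <= B * `|t - s|.
  move=> st; have -> : picard_step y t i - picard_step y s i =
    primitive g (Num.max t 0) - primitive g (Num.max s 0).
    by rewrite /picard_step -/g; ring.
  apply: le_trans (mono _ _ _ _) _.
  - by rewrite le_max lexx orbT.
  - by rewrite ge_max !le_max st lexx orbT.
  rewrite ler_wpM2l ?(B_ge0 i) // ger0_norm ?subr_ge0 //.
  rewrite /Num.max; case: ltP => ?; case: ltP => ?; lra.
move=> s t; have [st|/ltW ts] := leP s t; last exact: mono'.
by rewrite distrC [`|s - t|]distrC; exact: mono'.
Qed.

Lemma is_derive_picard_step y (i : I) (t : R) : lipB y -> 0 < t ->
  is_derive t 1 (fun s => picard_step y s i) (f (y t) i).
Proof.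
move=> yB t0; have cg := @lipB_continuous y i yB.
set g := fun s => _ in cg.
apply: (@near_eq_is_derive _ _ _
    (cst (x0 i) + (primitive g - cst (primitive g 0)) : R -> R)).
  near=> s; have s0 : 0 < s by near: s; exact: lt_nbhsr.
  by rewrite /picard_step -/g !fctE max_l // ltW.
have dg : is_derive t 1 (primitive g) (g t).
  by apply: is_derive_primitive => //; lra.
apply: is_derive_eq (is_deriveD (is_derive_cst _ _ _)
  (is_deriveB dg (is_derive_cst _ _ _))) _.
by rewrite add0r subr0.
Unshelve. all: by end_near. Qed.

Local Notation u := picard_iter.

Lemma picard_iter_lipB k : lipB (u k).
Proof.
elim: k => [|k IH]; last exact: picard_step_lipB.
by move=> i s t; rewrite subrr normr0 mulr_ge0 ?(B_ge0 i).
Qed.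

Lemma picard_iter0 k i : u k 0 i = x0 i.
Proof. by case: k => //= k; exact: picard_step0. Qed.

Lemma picard_iter_le0 k i t : t <= 0 -> u k t i = x0 i.
Proof.
by move=> t0; case: k => //= k; rewrite /picard_step max_r // subrr addr0.
Qed.

(** The factor 2 yields the contraction ratio 1/2; the added 1 gives [t <= expR (lam * t)] for the
    first increment. *)
Let lam : R := 2 * (`|C| * #|I|%:R) + 1.

Let lam_gt0 : 0 < lam.
Proof. by rewrite ltr_wpDl // !mulr_ge0. Qed.

(* Weighting by [expR (lam * t)] makes the Picard map a contraction of ratio 1/2. *)
Lemma picard_iter_contract k i t : 0 <= t ->
  `|u k.+1 t i - u k t i| <= B * (2^-1) ^+ k * expR (lam * t).
Proof.
have c_iter j l : continuous (fun s => u j s l).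
  by apply: lipschitz_continuous; exact: picard_iter_lipB.
elim: k i t => [|k IH] i t t0.
  rewrite expr0 mulr1; have -> : u 0%N t i = u 1%N 0 i by rewrite picard_iter0.
  apply: le_trans (picard_iter_lipB 1 i t 0) _.
  rewrite subr0 ger0_norm // ler_wpM2l ?(B_ge0 i) //.
  apply: le_trans (expR_ge1Dx _); have : 0 <= `|C| * #|I|%:R * t by rewrite !mulr_ge0.
  by rewrite /lam; lra.
pose a := B * (2^-1) ^+ k.+1.
have a0 : 0 <= a by rewrite mulr_ge0 ?(B_ge0 i) // exprn_ge0.
have dG (s : R) : is_derive s 1 (fun s => a * expR (lam * s)) (a * (expR (lam * s) * lam)).
  have dl : is_derive s 1 (fun s => lam * s) lam.
    apply: is_derive_eq (is_deriveZ lam (is_derive_id s 1)) _.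
    by rewrite /GRing.scale /= mulr1.
  exact: (is_deriveZ a (is_derive1_comp (is_derive_expR (lam * s)) dl)).
pose F s := u k.+2 s i - u k.+1 s i.
(* The derivative of the majorant is [lam] times itself, enough to dominate the Lipschitz bound
   obtained from the previous increment. *)
apply: (@norm_le_derive_le R F (fun s => f (u k.+1 s) i - f (u k s) i)
    (fun s => a * expR (lam * s)) (fun s => a * (expR (lam * s) * lam))) => //.
- by move=> s; apply: cvgB; [exact: (c_iter k.+2 i s)|exact: (c_iter k.+1 i s)].
- by move=> s; exact: is_derive1_continuous (dG s).
- move=> s s0; apply: is_deriveB.
    exact: is_derive_picard_step (picard_iter_lipB k.+1) s0.
  exact: is_derive_picard_step (picard_iter_lipB k) s0.
- move=> s s0; apply: le_trans (lipschitz_norm_le _ _ _) _.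
  apply: le_trans (_ : `|C| * (#|I|%:R * (2 * a * expR (lam * s))) <= _).
    rewrite ler_wpM2l // mulr_natl -sumr_const; apply: ler_sum => l _.
    have -> : 2 * a = B * (2^-1) ^+ k by rewrite /a exprS; field.
    exact/IH/ltW.
  have : 0 <= a * expR (lam * s) by rewrite mulr_ge0 ?expR_ge0.
  by rewrite /lam; lra.
- by rewrite /F !picard_iter0 subrr normr0 mulr_ge0 ?expR_ge0.
Qed.

(** At fixed [t] the telescoping series of increments is dominated by a geometric one. *)
Lemma picard_iter_cvg i t : cvgn (fun k => u k t i).
Proof.
have [t0|t0] := leP t 0.
  have -> : (fun k => u k t i) = cst (x0 i).
    by apply/funext => k; rewrite picard_iter_le0.
  exact: is_cvg_cst.
have -> : (fun k => u k t i) =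
    cst (u 0%N t i) + series (telescope (fun k => u k t i)).
  by apply/funext => k; rewrite [LHS](eq_sum_telescope (fun k => u k t i)).
apply: is_cvgD; first exact: is_cvg_cst.
apply: normed_cvg.
apply: (@series_le_cvg _ _ (geometric (B * expR (lam * t)) 2^-1)).
- by move=> k /=; exact: normr_ge0.
- by move=> k /=; rewrite !mulr_ge0 ?expR_ge0 ?(B_ge0 i) // exprn_ge0.
- move=> k /=; apply: le_trans (picard_iter_contract k i (ltW t0)) _.
  by rewrite mulrAC.
- apply: is_cvg_geometric_series; rewrite gtr0_norm //.
  by rewrite invf_lt1 // ltr1n.
Qed.

(** The time-Lipschitz bound and a quadratic bound on the first-order remainder are closed
    conditions, so the pointwise limit of the iterates inherits both; the second one yields the
    derivative. *)
Theorem picard_lindelof : exists x : R -> I -> R,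
  [/\ x 0 = x0,
      forall (t : R) i, 0 < t -> is_derive t 1 (fun s => x s i) (f (x t) i) &
      forall i s t, `|x s i - x t i| <= B * `|s - t|].
Proof.
pose x t i := limn (fun k => u k t i).
have x_lim i t : (fun k => u k t i) @ \oo --> x t i.
  exact: picard_iter_cvg.
have fx_lim i t : (fun k => f (u k t) i) @ \oo --> f (x t) i.
  apply/cvgrPdist_le => eps eps0.
  have sum_lim : (fun k => `|C| * \sum_l `|x t l - u k t l|) @ \oo -->
      `|C| * \sum_(l : I) `|x t l - x t l|.
    apply: cvgM; first exact: cvg_cst.
    apply: cvg_big => [|l _]; first exact: add_continuous.
    apply: cvg_norm; apply: cvgB; first exact: cvg_cst.
    exact: x_lim.
  rewrite big1 ?mulr0 in sum_lim; last by move=> l _; rewrite subrr normr0.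
  move/cvgrPdist_le: sum_lim => /(_ eps eps0); apply: filterS => k.
  rewrite sub0r normrN => H; apply: le_trans (lipschitz_norm_le _ _ _) _.
  by apply: le_trans H; exact: ler_norm.
have x_lip i s t : `|x s i - x t i| <= B * `|s - t|.
  have : (fun k => `|u k s i - u k t i|) @ \oo --> `|x s i - x t i|.
    by apply: cvg_norm; apply: cvgB; exact: x_lim.
  move/cvgr_to_le; apply; apply: nearW => k; exact: picard_iter_lipB.
exists x; split => //.
  apply/funext => i; have lim0 : (fun k => u k 0 i) @ \oo --> x0 i.
    have -> : (fun k => u k 0 i) = cst (x0 i).
      by apply/funext => k; rewrite picard_iter0.
    exact: cvg_cst.
  by apply: cvg_unique (x_lim i 0) lim0; exact: Rhausdorff.
move=> t i t0; pose M := `|C| * (#|I|%:R * B).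
have M0 : 0 <= M by rewrite !mulr_ge0 ?(B_ge0 i).
(* Unlike convergence of derivatives, this remainder bound, uniform in [k], only
   needs pointwise convergence to pass to the limit. *)
have step k (h : R) : `|h| < t -> `|u k.+1 (h + t) i - u k.+1 t i - h * f (u k t) i|
    <= M * h ^+ 2.
  (* Removing the linear part leaves the derivative [f (u k s) i - f (u k t) i], at most [M] times
     |h| between [t] and [h + t]; |h| < t keeps these times positive. *)
  move=> /ltr_normlP[ht _]; pose H s := u k.+1 s i - s * f (u k t) i.
  have cH : continuous H.
    have cu : continuous (fun s => u k.+1 s i).
      by apply: lipschitz_continuous; exact: (picard_iter_lipB k.+1 i).
    move=> s; apply: cvgB; first exact: (cu s).
    by apply: cvgM; [exact: cvg_id|exact: cvg_cst].
  have dH (s : R) : 0 < s -> is_derive s 1 H (f (u k s) i - f (u k t) i).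
    move=> s0; have d1 := is_derive_picard_step i (picard_iter_lipB k) s0.
    have d2 := is_derive1_affine 0 (f (u k t) i) s.
    have -> : H = (fun s => picard_step (u k) s i) -
       (fun s => 0 + s * f (u k t) i).
      by apply/funext => r; rewrite !fctE add0r.
    exact: is_deriveB d1 d2.
  have -> : u k.+1 (h + t) i - u k.+1 t i - h * f (u k t) i = H (h + t) - H t.
    by rewrite /H; ring.
  have dist_le s : `|s - t| <= `|h| -> `|f (u k s) i - f (u k t) i| <= M * `|h|.
    move=> sh; apply: le_trans (lipB_comp i (picard_iter_lipB k) s t) _.
    by rewrite ler_wpM2l.
  have hh : `|h| * `|h| = h ^+ 2 by rewrite -expr2 real_normK ?num_real.
  have [h0|h0|->] := ltgtP h 0; last by rewrite add0r subrr normr0 expr0n mulr0.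
  - have [||s /andP[s1 s2]|s /andP[s1 s2] E] := @MVT_continuous R H
      (fun s => f (u k s) i - f (u k t) i) (h + t) t.
    + by lra.
    + by move=> *; exact: cH.
    + by apply: dH; lra.
    rewrite distrC E normrM -hh mulrA; apply: ler_pM => //.
      by apply: dist_le; rewrite !ltr0_norm; lra.
    by rewrite gtr0_norm ?ltr0_norm; lra.
  - have [||s /andP[s1 s2]|s /andP[s1 s2] E] := @MVT_continuous R H
      (fun s => f (u k s) i - f (u k t) i) t (h + t).
    + by lra.
    + by move=> *; exact: cH.
    + by apply: dH; lra.
    rewrite E normrM -hh mulrA; apply: ler_pM => //.
      by apply: dist_le; rewrite !gtr0_norm; lra.
    by rewrite !gtr0_norm; lra.
apply: (@is_derive1_quadratic _ _ _ _ M t) => // h ht.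
have : (fun k => `|u k.+1 (h + t) i - u k.+1 t i - h * f (u k t) i|) @ \oo -->
    `|x (h + t) i - x t i - h * f (x t) i|.
  apply: cvg_norm; apply: cvgB.
    apply: cvgB.
      by rewrite (cvg_shiftS (fun k => u k (h + t) i)); exact: x_lim.
    by rewrite (cvg_shiftS (fun k => u k t i)); exact: x_lim.
  apply: cvgM; first exact: cvg_cst.
  exact: fx_lim.
by move/cvgr_to_le; apply; apply: nearW => k; exact: step.
Qed.

End Picard.

(** * Bounded Lipschitz functions *)

Section BoundedLipschitz.
Variables (R : realType) (I : finType).
Implicit Types h g : (I -> R) -> R.

(** Boundedness is carried along because products of Lipschitz functions need it; the clipped rates
    are then reached by closure under sums, products and inverses. *)
Definition bounded_lipschitz h : Prop := exists2 B : R,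
  forall x, `|h x| <= B & exists C : R,
  forall x y, `|h x - h y| <= C * \sum_k `|x k - y k|.

Lemma bounded_lipschitzW h : bounded_lipschitz h -> exists BC : R * R,
  [/\ 0 <= BC.1, 0 <= BC.2, forall x, `|h x| <= BC.1 &
    forall x y, `|h x - h y| <= BC.2 * \sum_k `|x k - y k|].
Proof.
move=> [B hB [C hC]]; exists (`|B|, `|C|); split => //= [x|x y].
  by rewrite (le_trans (hB x)) ?ler_norm.
by rewrite (le_trans (hC x y)) // ler_wpM2r ?ler_norm // sumr_ge0.
Qed.

Lemma bounded_lipschitz_cst (c : R) : bounded_lipschitz (fun=> c).
Proof.
exists `|c| => //; exists 0 => x y.
by rewrite subrr normr0 mul0r.
Qed.

Lemma bounded_lipschitzD h g : bounded_lipschitz h -> bounded_lipschitz g ->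
  bounded_lipschitz (fun x => h x + g x).
Proof.
move=> [B hB [C hC]] [B' gB [C' gC]]; exists (B + B').
  by move=> x; rewrite (le_trans (ler_normD _ _)) // lerD.
exists (C + C') => x y.
have -> : h x + g x - (h y + g y) = (h x - h y) + (g x - g y) by ring.
by rewrite (le_trans (ler_normD _ _)) // mulrDl lerD.
Qed.

Lemma bounded_lipschitzM h g : bounded_lipschitz h -> bounded_lipschitz g ->
  bounded_lipschitz (fun x => h x * g x).
Proof.
move=> /bounded_lipschitzW[[B C] /= [B0 C0 hB hC]].
move=> /bounded_lipschitzW[[B' C'] /= [B'0 C'0 gB gC]]; exists (B * B').
  by move=> x; rewrite normrM ler_pM.
exists (B * C' + C * B') => x y.
have -> : h x * g x - h y * g y = h x * (g x - g y) + (h x - h y) * g y by ring.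
apply: le_trans (ler_normD _ _) _; rewrite [leRHS]mulrDl !normrM lerD //.
  by rewrite -mulrA ler_pM.
by rewrite mulrAC ler_pM.
Qed.

Lemma bounded_lipschitzV h : bounded_lipschitz h -> (forall x, 1 <= h x) ->
  bounded_lipschitz (fun x => (h x)^-1).
Proof.
move=> [B hB [C hC]] h1; have h0 x : 0 < h x by rewrite (lt_le_trans ltr01).
have V1 x : `|(h x)^-1| <= 1 by rewrite gtr0_norm ?invr_gt0 // invf_le1.
exists 1 => //; exists C => x y.
have -> : (h x)^-1 - (h y)^-1 = - ((h x)^-1 * (h y)^-1 * (h x - h y)).
  by field; rewrite !gt_eqF.
rewrite normrN normrM (le_trans _ (hC x y)) // ler_piMl // normrM.
by rewrite -[leRHS]mulr1 ler_pM.
Qed.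

(** Clipping is 1-Lipschitz with values at least [w], so only [phi] on that half-line matters. *)
Lemma bounded_lipschitz_clip (phi : R -> R) (w B C : R) (k : I) :
  (forall t, w <= t -> `|phi t| <= B) -> 0 <= C ->
  (forall s t, w <= s -> s < t -> `|phi t - phi s| <= C * (t - s)) ->
  bounded_lipschitz (fun x => phi (Num.max (x k) w)).
Proof.
move=> phiB C0 phiC; have max_w (a : R) : w <= Num.max a w by rewrite le_max lexx orbT.
exists B; first by move=> x; exact: phiB.
exists C => x y; apply: le_trans (_ : C * `|x k - y k| <= _); last first.
  by rewrite ler_wpM2l // (bigD1 k) //= lerDl sumr_ge0.
have phi_le s t : w <= s -> w <= t -> `|phi s - phi t| <= C * `|s - t|.
  move=> ws wt; have [st|ts|->] := ltgtP s t; last by rewrite !subrr normr0 mulr0.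
    by rewrite distrC [`|s - t|]distrC (gtr0_norm (_ : 0 < t - s)) ?subr_gt0 ?phiC.
  by rewrite (gtr0_norm (_ : 0 < s - t)) ?subr_gt0 ?phiC.
apply: le_trans (phi_le _ _ (max_w _) (max_w _)) _; rewrite ler_wpM2l //.
by rewrite ler_norml /Num.max; case: ltP => ?; case: ltP => ?;
  have [?|?] := ler0P (x k - y k); lra.
Qed.

End BoundedLipschitz.

Lemma is_derive_expRM (R : realType) (c t : R) :
  is_derive t 1 (fun s => expR (- (c * s))) (- c * expR (- (c * t))).
Proof.
have dl : is_derive t 1 (fun s => - (c * s)) (- c).
  have := is_derive1_affine 0 (- c) t; congr (is_derive _ _ _ _).
  by apply/funext => s; ring.
by rewrite mulrC; exact: (@is_derive1_comp _ expR (fun s => - (c * s)) t _ _ (is_derive_expR _) dl).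
Qed.

Lemma derive_bound_lipschitz (R : realType) (phi dphi : R -> R) (w C : R) :
  (forall t, w <= t -> is_derive t 1 phi (dphi t)) ->
  (forall t, w <= t -> `|dphi t| <= C) ->
  forall s t, w <= s -> s < t -> `|phi t - phi s| <= C * (t - s).
Proof.
move=> dp dC s t ws st; have [||r /andP[sr rt] ->] := @MVT_continuous R phi dphi s t st.
- move=> r; rewrite in_itv /= => /andP[sr _].
  by apply: is_derive1_continuous (dp r _); lra.
- by move=> r /andP[sr _]; apply: dp; lra.
rewrite normrM (gtr0_norm (_ : 0 < t - s)) ?subr_gt0 //.
by rewrite ler_pM2r ?subr_gt0 // dC //; lra.
Qed.

(** The bound passes through the square of [1 + t] and [1 + t <= expR t]. It lets a decaying
    exponential absorb a power. *)
Lemma powR_le_expR (R : realType) (q t : R) : 0 <= q <= 2 -> 0 <= t ->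
  t `^ q <= expR (2 * t).
Proof.
move=> /andP[q0 q2] t0; apply: le_trans (_ : (1 + t) `^ q <= _).
  by apply: ge0_ler_powR; rewrite ?nnegrE //; lra.
apply: le_trans (_ : (1 + t) `^ 2 <= _); first by apply: ler_powR => //; lra.
rewrite powR_mulrn; last lra.
rewrite mulrC expRM_natr ler_sqr ?nnegrE ?expR_ge0 //; last lra.
exact: expR_ge1Dx.
Qed.

Section ClippedExponentials.
Variables (R : realType) (I : finType) (w : R) (k : I).
Hypothesis w0 : 0 < w.

Lemma bounded_lipschitz_expR (c : R) : 0 <= c ->
  bounded_lipschitz (fun x : I -> R => expR (- (c * Num.max (x k) w))).
Proof.
move=> c0; have e1 t : w <= t -> `|expR (- (c * t))| <= 1.
  move=> wt; rewrite gtr0_norm ?expR_gt0 // expR_le1 oppr_le0 mulr_ge0 //.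
  exact/ltW/(lt_le_trans w0).
apply: (@bounded_lipschitz_clip _ _ (fun t => expR (- (c * t))) w 1 c) => //.
apply: (derive_bound_lipschitz (fun t _ => is_derive_expRM c t)) => t wt.
by rewrite normrM normrN (ger0_norm c0) ler_piMr ?e1.
Qed.

(** The power alone is unbounded; against [expR (- (c * t))] with [2 <= c], both it and the lower
    power in the derivative stay at most 1, whence the constant [p + c]. *)
Lemma bounded_lipschitz_powR (c p : R) : 2 <= c -> 1 <= p <= 2 ->
  bounded_lipschitz (fun x : I -> R =>
    expR (- (c * Num.max (x k) w)) * (Num.max (x k) w) `^ p).
Proof.
move=> c2 /andP[p1 p2].
have e1 q t : 0 <= q <= 2 -> w <= t -> `|expR (- (c * t)) * t `^ q| <= 1.
  move=> q02 wt; have t0 : 0 <= t := ltW (lt_le_trans w0 wt).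
  rewrite ger0_norm ?mulr_ge0 ?expR_ge0 ?powR_ge0 //.
  rewrite expRN mulrC ler_pdivrMr ?expR_gt0 // mul1r.
  apply: le_trans (powR_le_expR q02 t0) _.
  by rewrite ler_expR ler_wpM2r.
apply: (@bounded_lipschitz_clip _ _ (fun t => expR (- (c * t)) * t `^ p) w 1 (p + c)).
- by move=> t wt; apply: e1 => //; lra.
- by lra.
apply: (@derive_bound_lipschitz _ _ (fun t =>
    p * (expR (- (c * t)) * t `^ (p - 1)) - c * (expR (- (c * t)) * t `^ p))).
  move=> t wt; have t0 : 0 < t := lt_le_trans w0 wt.
  have H := is_deriveM (is_derive_expRM c t) (is_derive1_powR p t0).
  apply: is_derive_eq H _.
  by rewrite /GRing.scale /=; ring.
move=> t wt; apply: le_trans (ler_normB _ _) _.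
have p0 : 0 <= p by lra.
have c0 : 0 <= c by lra.
apply: lerD; rewrite normrM ger0_norm // ler_piMr ?e1 //.
- by apply/andP; split; lra.
- by rewrite p0.
Qed.

End ClippedExponentials.

(** * The two-valued system *)

Section TwoValuedSystem.
Variables (R : realType) (K p : R).
Hypotheses (K4 : 4 <= K) (p1 : 1 < p) (p2 : p <= 2).

(** At a state equal to [v] in one coordinate [w] and to [u] elsewhere, [uniform_weight] is the
    exponential at the indices [j] where [Psi j w] is 0, and [gap_weight] at those where it is 2.
    There are [K / 2 - 1] and [K / 2] such indices, so [total_weight] is the denominator;
    [bulk_rate] and [lag_rate] are the field off [w] and at [w]. *)
Definition uniform_weight (u : R) : R := expR (- (K * u)).
Definition gap_weight (u v : R) : R := expR (- ((K - 2) * u)) * expR (- (2 * v)).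
Definition total_weight (u v : R) : R :=
  1 + K / 2 * gap_weight u v + (K / 2 - 1) * uniform_weight u.
Definition bulk_rate (u v : R) : R :=
  (total_weight u v)^-1 * (K / 2 * (gap_weight u v + uniform_weight u)) * u `^ p.
Definition lag_rate (u v : R) : R :=
  (total_weight u v)^-1 * (K * gap_weight u v) * v `^ p.

Lemma uniform_weight_gt0 u : 0 < uniform_weight u.
Proof. exact: expR_gt0. Qed.

Lemma gap_weight_gt0 u v : 0 < gap_weight u v.
Proof. by rewrite mulr_gt0 ?expR_gt0. Qed.

Lemma total_weight_ge1 u v : 1 <= total_weight u v.
Proof.
have hK := K4.
have g0 : 0 <= K / 2 * gap_weight u v.
  by rewrite mulr_ge0 ?(ltW (gap_weight_gt0 _ _)) //; lra.
have e0 : 0 <= (K / 2 - 1) * uniform_weight u.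
  by rewrite mulr_ge0 ?(ltW (uniform_weight_gt0 _)) //; lra.
by rewrite /total_weight; lra.
Qed.

Lemma total_weight_gt0 u v : 0 < total_weight u v.
Proof. exact: lt_le_trans (total_weight_ge1 u v). Qed.

Lemma bulk_rate_ge0 u v : 0 <= bulk_rate u v.
Proof.
have hK := K4.
rewrite mulr_ge0 ?powR_ge0 // mulr_ge0 ?invr_ge0 ?(ltW (total_weight_gt0 _ _)) //.
rewrite mulr_ge0 ?addr_ge0 ?(ltW (uniform_weight_gt0 _)) ?(ltW (gap_weight_gt0 _ _)) //.
by lra.
Qed.

Lemma lag_rate_ge0 u v : 0 <= lag_rate u v.
Proof.
have hK := K4.
rewrite mulr_ge0 ?powR_ge0 // mulr_ge0 ?invr_ge0 ?(ltW (total_weight_gt0 _ _)) //.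
rewrite mulr_ge0 ?(ltW (gap_weight_gt0 _ _)) //; lra.
Qed.

(** The weights are at most 1, so the denominator is at most [K]; [uniform_weight u] alone bounds
    the numerator, and the power is at least 1. *)
Lemma bulk_rate_ge u v M : 0 <= v -> 1 <= u <= M ->
  expR (- (K * M)) / 2 <= bulk_rate u v.
Proof.
move=> v0 /andP[u1 uM]; have hK := K4; have hp := p1.
have G0 := gap_weight_gt0 u v; have E0 : 0 < uniform_weight u := uniform_weight_gt0 u.
have EM : expR (- (K * M)) <= uniform_weight u.
  by rewrite ler_expR lerN2 ler_wpM2l //; lra.
have E1 : uniform_weight u <= 1.
  by rewrite expR_le1 oppr_le0 mulr_ge0 //; lra.
have G1 : gap_weight u v <= 1.
  by rewrite mulr_ile1 ?expR_ge0 // expR_le1 oppr_le0 mulr_ge0 //; lra.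
have T0 := total_weight_gt0 u v.
have TK : total_weight u v <= K.
  have g0 : K / 2 * gap_weight u v <= K / 2 * 1 by rewrite ler_wpM2l //; lra.
  have e0 : (K / 2 - 1) * uniform_weight u <= (K / 2 - 1) * 1.
    by rewrite ler_wpM2l //; lra.
  by rewrite /total_weight; lra.
have up : 1 <= u `^ p by apply: (le_trans u1); apply: le1r_powR; lra.
apply: le_trans (_ : (total_weight u v)^-1 *
    (K / 2 * (gap_weight u v + uniform_weight u)) <= _); last first.
  rewrite ler_peMr // mulr_ge0 ?invr_ge0 ?(ltW T0) // mulr_ge0 //; first by lra.
  by rewrite addr_ge0 // ltW.
rewrite [leRHS]mulrC ler_pdivlMr //.
apply: le_trans (_ : uniform_weight u / 2 * K <= _).
  by apply: ler_pM; rewrite ?(ltW T0) ?divr_ge0 ?expR_ge0 // ler_pM2r // invr_gt0.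
have : 0 <= K * gap_weight u v by rewrite mulr_ge0 ?(ltW G0) //; lra.
by lra.
Qed.

Variables (u0 v0 : R).
Hypotheses (v0_gt0 : 0 < v0) (v0_le_u0 : v0 <= u0).

(* The rates are evaluated at [max x v0]: both coordinates of a solution started
   at [(u0, v0)] stay above [v0], and clipping makes the rates globally bounded
   and Lipschitz. *)
Definition clipped_rate (x : bool -> R) (b : bool) : R :=
  let u := Num.max (x true) v0 in
  let v := Num.max (x false) v0 in
  if b then bulk_rate u v else lag_rate u v.

(** Each power is paired with an exponential in the same variable of rate at least 2: [K - 2] and
    [K] for [u], 2 for [v]. *)
Lemma clipped_rate_bounded_lipschitz b :
  bounded_lipschitz (fun x => clipped_rate x b).
Proof.
have hK := K4; have hp := p1; have hp2 := p2.
have Ku (c : R) (k : bool) : 0 <= c ->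
  bounded_lipschitz (fun x => expR (- (c * Num.max (x k) v0))) :=
  bounded_lipschitz_expR k v0_gt0 (c := c).
have Kp (c : R) (k : bool) : 2 <= c -> bounded_lipschitz (fun x : bool -> R =>
    expR (- (c * Num.max (x k) v0)) * (Num.max (x k) v0) `^ p).
  by move=> c2; apply: bounded_lipschitz_powR => //; lra.
have eK : bounded_lipschitz (fun x => expR (- (K * Num.max (x true) v0))).
  by apply: Ku; lra.
have eK2 : bounded_lipschitz (fun x => expR (- ((K - 2) * Num.max (x true) v0))).
  by apply: Ku; lra.
have e2 : bounded_lipschitz (fun x => expR (- (2 * Num.max (x false) v0))).
  by apply: Ku.
have invT := bounded_lipschitzV (bounded_lipschitzD (bounded_lipschitzD
  (bounded_lipschitz_cst bool 1) (bounded_lipschitzM (bounded_lipschitz_cst bool (K / 2))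
  (bounded_lipschitzM eK2 e2))) (bounded_lipschitzM
  (bounded_lipschitz_cst bool (K / 2 - 1)) eK))
  (fun x => total_weight_ge1 (Num.max (x true) v0) (Num.max (x false) v0)).
have H := bounded_lipschitzM invT.
case: b.
  have K2 : 2 <= K - 2 by lra.
  have K2' : 2 <= K by lra.
  have := H _ (bounded_lipschitzM (bounded_lipschitz_cst bool (K / 2))
    (bounded_lipschitzD (bounded_lipschitzM (Kp _ true K2) e2) (Kp _ true K2'))).
  congr bounded_lipschitz; apply/funext => x.
  by rewrite /clipped_rate /bulk_rate /total_weight /gap_weight /uniform_weight; ring.
have := H _ (bounded_lipschitzM (bounded_lipschitz_cst bool K)
  (bounded_lipschitzM eK2 (Kp _ false (lexx 2)))).
congr bounded_lipschitz; apply/funext => x.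
by rewrite /clipped_rate /lag_rate /total_weight /gap_weight /uniform_weight; ring.
Qed.

Lemma clipped_rate_ge0 x b : 0 <= clipped_rate x b.
Proof. by case: b; [exact: bulk_rate_ge0|exact: lag_rate_ge0]. Qed.

Lemma nondecreasing_of_derive (F dF : R -> R) : continuous F ->
  (forall t : R, 0 < t -> is_derive t 1 F (dF t)) ->
  (forall t, 0 < t -> 0 <= dF t) ->
  forall s t, 0 <= s -> s <= t -> F s <= F t.
Proof.
move=> cF HF dF0 s t s0; rewrite le_eqVlt => /predU1P[->//|st].
have [||r /andP[sr rt] E] := @MVT_continuous R F dF s t st.
- by move=> r _; exact: cF.
- by move=> r /andP[sr _]; apply: HF; lra.
by rewrite -subr_ge0 E mulr_ge0 ?subr_ge0 ?(ltW st) // dF0 //; lra.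
Qed.

(** Nonnegative rates make both coordinates nondecreasing, so the clipping is never active for
    [t >= 0]. *)
Lemma two_valued_solution : exists u v : R -> R,
  [/\ u 0 = u0, v 0 = v0,
      forall t, 0 <= t -> u0 <= u t /\ v0 <= v t,
      (continuous u /\ continuous v) &
      forall t : R, 0 < t -> is_derive t 1 u (bulk_rate (u t) (v t)) /\
                         is_derive t 1 v (lag_rate (u t) (v t))].
Proof.
have [[Bt Ct] /= [Bt0 Ct0 tB tC]] :=
  bounded_lipschitzW (clipped_rate_bounded_lipschitz true).
have [[Bf Cf] /= [Bf0 Cf0 fB fC]] :=
  bounded_lipschitzW (clipped_rate_bounded_lipschitz false).
have rB x b : `|clipped_rate x b| <= Bt + Bf.
  by case: b; [rewrite (le_trans (tB x)) // lerDl|rewrite (le_trans (fB x)) // lerDr].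
have rC x y b : `|clipped_rate x b - clipped_rate y b| <=
    (Ct + Cf) * \sum_k `|x k - y k|.
  have s0 : 0 <= \sum_k `|x k - y k| by rewrite sumr_ge0.
  case: b; [apply: le_trans (tC x y) _|apply: le_trans (fC x y) _];
  by rewrite ler_wpM2r // ?lerDl ?lerDr.
have [x [x_init x_derive x_lip]] :=
  picard_lindelof rB rC (fun b => if b then u0 else v0).
have cx b : continuous (fun t => x t b).
  by apply: lipschitz_continuous; exact: x_lip.
have x_ge b t : 0 <= t -> (if b then u0 else v0) <= x t b.
  move=> t0; have -> : (if b then u0 else v0) = x 0 b by rewrite x_init.
  apply: (nondecreasing_of_derive (cx b) (fun t => x_derive t b)) => // r _.
  exact: clipped_rate_ge0.
have v_max t : 0 <= t -> Num.max (x t false) v0 = x t false.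
  by move=> t0; rewrite max_l // (x_ge false).
have u_max t : 0 <= t -> Num.max (x t true) v0 = x t true.
  by move=> t0; rewrite max_l // (le_trans v0_le_u0) // (x_ge true).
exists (fun t => x t true), (fun t => x t false); split.
- by rewrite x_init.
- by rewrite x_init.
- by move=> t t0; split; [exact: (x_ge true)|exact: (x_ge false)].
- by split; exact: cx.
move=> t t0; have := x_derive t true t0; have := x_derive t false t0.
by rewrite /clipped_rate u_max ?v_max ?(ltW t0).
Qed.

End TwoValuedSystem.

(** * A solution with one coordinate bounded and the other escaping to infinity *)

Section Escape.
Variables (R : realType) (K p : R).
Hypotheses (K4 : 4 <= K) (p1 : 1 < p) (p2 : p <= 2).

(** Passing to the power [1 - p] straightens the equation: the chain rule cancels the power [p] of
    [x t]. *)
Lemma is_derive_powR_rate (x dx : R -> R) (t : R) :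
  0 < x t -> is_derive t 1 x (dx t * x t `^ p) ->
  is_derive t 1 (fun s => x s `^ (1 - p)) ((1 - p) * dx t).
Proof.
move=> x0 dX; have dP := is_derive1_powR (1 - p) x0.
apply: is_derive_eq (@is_derive1_comp _ (fun y => y `^ (1 - p)) x t _ _ dP dX) _.
have -> : 1 - p - 1 = - p by ring.
rewrite powRN; field.
by rewrite gt_eqF // powR_gt0.
Qed.

Lemma escaping_solution : exists u v : R -> R,
  [/\ forall t, 0 <= t -> [/\ 1 <= u t, 0 < v t & v t <= 1],
      (continuous u /\ continuous v),
      forall t : R, 0 < t -> is_derive t 1 u (bulk_rate K p (u t) (v t)) /\
                         is_derive t 1 v (lag_rate K p (u t) (v t)) &
      forall M, exists2 T, 1 <= T & forall t, T <= t -> M <= u t].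
Proof.
have hK := K4; have hp := p1.
(* Chosen so that the power [1 - p] of [v0] is 3; with [u 0 = 1] the quantity [W] below starts at
   [3 - 2 = 1]. *)
pose v0 : R := 3 `^ (1 - p)^-1.
have v00 : 0 < v0 by rewrite powR_gt0.
have p10 : 1 - p < 0 by lra.
have v01 : v0 <= 1.
  by rewrite -[leRHS](powRr0 3) ler_powR ?ler1n // ltW // invr_lt0.
have [u [v [u_init v_init ge_init [cu cv] dUV]]] :=
  two_valued_solution K4 p1 p2 v00 v01.
have u1 t : 0 <= t -> 1 <= u t by move=> /ge_init[].
have vpos t : 0 <= t -> 0 < v t by move=> /ge_init[_]; exact: lt_le_trans.
(* The factor [2] makes the terms in [gap_weight] cancel in the derivative of [W]. *)
pose W t := v t `^ (1 - p) - 2 * u t `^ (1 - p).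
pose dW t := (p - 1) * K * (total_weight K (u t) (v t))^-1 * uniform_weight K (u t).
have T0 t := total_weight_gt0 K4 (u t) (v t).
have dW_derive (t : R) : 0 < t -> is_derive t 1 W (dW t).
  move=> t0; have [dU dV] := dUV t t0.
  have u0t : 0 < u t by apply: lt_le_trans (u1 t (ltW t0)).
  have := is_derive_powR_rate (dx := fun t => (total_weight K (u t) (v t))^-1 *
    (K / 2 * (gap_weight K (u t) (v t) + uniform_weight K (u t)))) u0t dU.
  have := is_derive_powR_rate (dx := fun t => (total_weight K (u t) (v t))^-1 *
    (K * gap_weight K (u t) (v t))) (vpos t (ltW t0)) dV.
  move=> dv du; have H := is_deriveB dv (is_deriveZ 2 du).
  apply: is_derive_eq H _.
  by rewrite /dW /GRing.scale /=; field; rewrite gt_eqF.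
have cW t : 0 <= t -> {for t, continuous W}.
  have cpow (x : R -> R) : continuous x -> 0 < x t ->
      {for t, continuous (fun s => x s `^ (1 - p))}.
    move=> cx x0; apply: (@continuous_comp _ _ _ x (fun y => y `^ (1 - p))).
      exact: cx.
    exact: is_derive1_continuous (is_derive1_powR (1 - p) x0).
  move=> t0; apply: cvgB; first exact: cpow (vpos t t0).
  apply: cvgM; first exact: cvg_cst.
  by apply: cpow => //; apply: lt_le_trans (u1 t t0).
have W0 : W 0 = 1.
  rewrite /W u_init v_init /v0 powR1 -powRrM mulVf ?powRr1 ?lt_eqF //.
  by ring.
have W1 t : 0 <= t -> 1 <= W t.
  rewrite le_eqVlt => /predU1P[<-|t0]; first by rewrite W0.
  have [||r /andP[r0 rt] E] := @MVT_continuous R W dW 0 t t0.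
  - by move=> r; rewrite in_itv /= => /andP[/cW].
  - by move=> r /andP[r0 _]; exact: dW_derive.
  rewrite -W0 -subr_ge0 E mulr_ge0 ?subr_ge0 ?(ltW t0) //.
  rewrite /dW mulr_ge0 ?(ltW (uniform_weight_gt0 _ _)) // mulr_ge0 ?invr_ge0 ?(ltW (T0 _)) //.
  by rewrite mulr_ge0 //; lra.
have v1 t : 0 <= t -> v t <= 1.
  move=> t0; rewrite leNgt; apply/negP => vt.
  have : v t `^ (1 - p) < 1.
    by rewrite /powR gt_eqF ?vpos // expR_lt1 nmulr_rlt0 // ln_gt0.
  have := W1 t t0; have := powR_ge0 (u t) (1 - p).
  by rewrite /W; lra.
have u_nd s t : 0 <= s -> s <= t -> u s <= u t.
  have dU (r : R) : 0 < r -> is_derive r 1 u (bulk_rate K p (u r) (v r)).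
    by move=> /dUV[].
  by apply: nondecreasing_of_derive cu dU _ s t => r _; exact: bulk_rate_ge0.
exists u, v; split => //.
  by move=> t t0; split; [exact: u1|exact: vpos|exact: v1].
(* If [u T] were below [M], the rate of [u] would be at least [k] on the whole of [0, T], and the
   mean value theorem would give [u T >= 1 + k * T > M]. *)
move=> M; pose k := expR (- (K * M)) / 2; have k0 : 0 < k by rewrite divr_gt0 ?expR_gt0.
pose T := Num.max 1 (M / k).
have T1 : 1 <= T by rewrite le_max lexx.
have T_gt0 : 0 < T by apply: lt_le_trans T1.
exists T => // t Tt; apply: le_trans (u_nd T t (ltW T_gt0) Tt).
rewrite leNgt; apply/negP => uT.
have [||r /andP[r0 rT] E] := @MVT_continuous R u
  (fun r => bulk_rate K p (u r) (v r)) 0 T T_gt0.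
- by move=> r _; exact: cu.
- by move=> r /andP[/dUV[]].
have rate_ge : k <= bulk_rate K p (u r) (v r).
  apply: bulk_rate_ge => //; first exact/ltW/vpos/ltW.
  rewrite (u1 r (ltW r0)) /=; apply: le_trans (ltW uT).
  exact: u_nd (ltW r0) (ltW rT).
have : M <= k * T by rewrite mulrC -ler_pdivrMr // le_max lexx orbT.
have : k * T <= bulk_rate K p (u r) (v r) * T by rewrite ler_pM2r.
by rewrite subr0 u_init in E; lra.
Qed.

End Escape.

(** * Trajectories with a lagging coordinate *)

Section LaggingCoordinate.
Variables (R : realType) (m L : nat).
Hypothesis m2 : (2 <= m)%N.
Local Notation n := (2 ^ m).-1.
Local Notation N := (n%:R : R).
Local Notation K := ((2 ^ m)%:R : R).
Local Notation p := ((2 * L)%:R / L.+1%:R : R).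
Variable w : 'I_n.

Definition lagging (u v : R) : 'I_n -> R := fun i => if i == w then v else u.

(** [Psi j w] takes only the values 0 and 2, so the exponential is affine in it; sums over [j] then
    reduce to row sums of [Psi] and entries of its square. *)
Lemma lagging_expR u v j :
  expR (- Psia (lagging u v) j) =
  uniform_weight K u + Psi R m j w / 2 * (gap_weight K u v - uniform_weight K u).
Proof.
have -> : Psia (lagging u v) j = K * u + Psi R m j w * (v - u).
  rewrite -(Psi_row_sum R j) mulr_suml /Psia (bigD1 w) //= [in RHS](bigD1 w) //=.
  rewrite /lagging eqxx (eq_bigr (fun k => Psi R m j k * u)); first by ring.
  by move=> k /negbTE->.
rewrite /gap_weight /uniform_weight.
case: (Psi_02 R j w) => ->; first by rewrite !mul0r !addr0.
have -> : - (K * u + 2 * (v - u)) = - ((K - 2) * u) + - (2 * v) by ring.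
by rewrite expRD divff // mul1r subrKC.
Qed.

(** The diagonal entries of the square of [Psi] are [2 * K] and the others [K], hence only two
    values: the plane of two-valued states is invariant. *)
Lemma lagging_bcoef u v i :
  bcoef (lagging u v) i = if i == w then K * gap_weight K u v
    else K / 2 * (gap_weight K u v + uniform_weight K u).
Proof.
rewrite /bcoef (eq_bigr (fun j => Psi R m i j * uniform_weight K u +
  Psi R m i j * Psi R m j w * ((gap_weight K u v - uniform_weight K u) / 2))).
  2: by move=> j _; rewrite lagging_expR; ring.
rewrite big_split /= -!mulr_suml Psi_row_sum Psi_sqr.
by case: eqP => _ /=; field.
Qed.

Lemma lagging_Dden u v : Dden (lagging u v) = total_weight K u v.
Proof.
rewrite /Dden (eq_bigr (fun j => uniform_weight K u +
  Psi R m w j * ((gap_weight K u v - uniform_weight K u) / 2))).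
  2: by move=> j _; rewrite lagging_expR Psi_sym; ring.
rewrite big_split /= sumr_const card_ord -!mulr_suml Psi_row_sum.
rewrite -[X in 1 + (X + _)]mulr_natr natr_pred_pow2 /total_weight.
by field.
Qed.

Lemma lagging_field u v :
  field L (lagging u v) = lagging (bulk_rate K p u v) (lag_rate K p u v).
Proof.
apply/funext => i; rewrite /field lagging_bcoef lagging_Dden.
by rewrite {2}/lagging /lagging; case: eqP.
Qed.

(** Coordinates of the direction are at most 1, so the discarded logarithms only increase the
    divergence. *)
Lemma KLunif_ge (a : 'I_n -> R) i : (forall k, 0 < a k) ->
  - ln N - N^-1 * ln (dir a i) <= KLunif m a.
Proof.
move=> a0; have N3 := natr_pred_pow2_ge3 R m2.
have s0 : 0 < norm1 a.
  rewrite /norm1 (bigD1 i) //= ltr_wpDr ?normr_gt0 ?gt_eqF //.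
  by rewrite sumr_ge0.
have dir_le1 k : dir a k <= 1.
  rewrite -(sum_dir s0 a0) (bigD1 k) //= lerDl sumr_ge0 // => j _.
  by rewrite divr_ge0 ?ltW.
rewrite /KLunif lerD2l lerN2 ler_wpM2l ?invr_ge0 //.
rewrite (bigD1 i) //= gerDl sumr_le0 // => j _.
exact: ln_le0.
Qed.

(** With [v <= 1] and norm at least [u], the lagging coordinate of the direction is at most
    [u^-1]. *)
Lemma lagging_KL_ge u v : 1 <= u -> 0 < v -> v <= 1 ->
  - ln N + N^-1 * ln u <= KLunif m (lagging u v).
Proof.
move=> u1 v0 v1; have u0 : 0 < u by apply: lt_le_trans u1.
have N3 := natr_pred_pow2_ge3 R m2.
have a0 k : 0 < lagging u v k by rewrite /lagging; case: eqP.
apply: le_trans (KLunif_ge w a0); rewrite lerD2l -mulrN ler_wpM2l ?invr_ge0 //.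
have [i iw] : exists i, i != w.
  pose j0 : 'I_n := Ordinal (ltn_trans (ltn0Sn 1) (pred_pow2_ge3 m2)).
  pose j1 : 'I_n := Ordinal (ltn_trans (ltnSn 1) (pred_pow2_ge3 m2)).
  by have [<-|] := eqVneq j0 w; [exists j1|exists j0].
have su : u <= norm1 (lagging u v).
  rewrite /norm1 (bigD1 i) //= {1}/lagging (negbTE iw) (gtr0_norm u0) lerDl.
  by rewrite sumr_ge0.
have s0 : 0 < norm1 (lagging u v) by apply: lt_le_trans su.
rewrite -lnV ?posrE ?divr_gt0 // ler_ln ?posrE ?invr_gt0 ?divr_gt0 //.
rewrite /dir invf_div (ler_pdivlMr _ _ (a0 w)).
rewrite /lagging eqxx -/(lagging u v).
by apply: le_trans su; rewrite ler_piMr // ltW.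
Qed.

Lemma lagging_trajectory : (1 < L)%N ->
  exists x : R -> 'I_n -> R, trajectory m L x /\
    forall A : R, exists2 T : R, 0 < T & forall t, T <= t -> A <= KLunif m (x t).
Proof.
move=> L1; have p1 := exponent_gt1 R L1.
have p2 : p <= 2.
  by rewrite ler_pdivrMr // -natrM ler_nat leq_mul2l leqnSn orbT.
have K4 : 4 <= K by rewrite (ler_nat R 4) (@leq_pexp2l 2 2 m).
have [u [v [bounds [cu cv] dUV u_oo]]] := escaping_solution K4 p1 p2.
exists (fun t => lagging (u t) (v t)); split.
  split; [|split].
  - by move=> i; have [u1 v0 _] := bounds 0 (lexx 0); rewrite /lagging; case: eqP => // _;
      apply: lt_le_trans u1.
  - move=> t t0 i; rewrite lagging_field; have [dU dV] := dUV t t0.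
    by rewrite /lagging derive1E; case: eqP => _; split; [case: dV|case: dV|case: dU|case: dU].
  - move=> i; apply: cvg_at_right_filter; rewrite /lagging.
    by case: eqP => _; [exact: cv|exact: cu].
have N3 := natr_pred_pow2_ge3 R m2; have N0 : 0 < N by lra.
(* The threshold on [u] at which the lower bound of [lagging_KL_ge] reaches [A]. *)
move=> A; have [T T1 uT] := u_oo (expR (N * (A + ln N))).
exists T; first by apply: lt_le_trans T1.
move=> t Tt; have t0 : 0 <= t by apply: le_trans Tt; apply: le_trans T1.
have [u1 v0 v1] := bounds t t0.
apply: le_trans (lagging_KL_ge u1 v0 v1).
rewrite -lerBlDl opprK -(ler_pM2l N0) mulVKf ?gt_eqF //.
by rewrite -ler_expR lnK ?posrE ?uT // (lt_le_trans _ u1).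
Qed.

End LaggingCoordinate.

Unset Implicit Arguments.
Set Strict Implicit.

Theorem theorem4p3 (R : realType) (m L : nat) (hm : (2 <= m)%N) (hL : (1 <= L)%N) :
  let n := ((2 ^ m).-1)%N in
  let c := (L%:R - 1) / (L%:R + 1) * n%:R : R in
  (* (i) *)
  ((forall s : R, c < s -> stable_at m L (unif m) s) /\
   (forall s : R, 0 < s -> s < c -> unstable_at m L (unif m) s)) /\
  (* (ii) *)
  ((1 < L)%N ->
    exists dstar : 'I_n -> R,
      [/\ (forall i, 0 <= dstar i), \sum_i dstar i = 1,
          (exists i, dstar i = 0) &
          exists2 tau : R, 0 < tau &
            forall s : R, tau < s -> stable_at m L dstar s]) /\
  (* (iii) *)
  ((1 < L)%N ->
    (exists x : R -> 'I_n -> R, trajectory m L x /\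
       exists t1 t2 : R, 0 <= t1 /\ t1 < t2 /\ KLunif m (x t1) < KLunif m (x t2)) /\
    (exists x : R -> 'I_n -> R, trajectory m L x /\
       (fun t => KLunif m (x t)) @ +oo --> +oo)).
Proof.
have w : 'I_((2 ^ m).-1) by exact: (Ordinal (ltn_trans (ltn0Sn 1) (pred_pow2_ge3 hm))).
move=> n c; have L0 : 1 <= L%:R :> R by rewrite (ler_nat R 1).
(* Nonnegativity, from [1 <= L], turns [c < s] into [0 < s]. *)
have c0 : 0 <= c by rewrite mulr_ge0 // divr_ge0 // ?subr_ge0 // addr_ge0.
split; first split.
- by move=> s cs; apply: uniform_stable => //; apply: le_lt_trans cs.
- by move=> s s0 sc; exact: uniform_unstable.
split=> L1.
  exists (fun i => (i == w)%:R); split.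
  - by move=> i; rewrite ler0n.
  - rewrite (bigD1 w) //= eqxx big1 ?addr0 // => i.
    by move=> /negbTE->.
  - pose j0 : 'I_n := Ordinal (ltn_trans (ltn0Sn 1) (pred_pow2_ge3 hm)).
    pose j1 : 'I_n := Ordinal (ltn_trans (ltnSn 1) (pred_pow2_ge3 hm)).
    by have [<-|/negbTE j0w] := eqVneq j0 w; [exists j1|exists j0; rewrite j0w].
  (* Vertices are stable at every positive level, so the value 1 is arbitrary. *)
  - exists 1 => // s s1; apply: vertex_stable => //.
    exact: lt_trans s1.
(* One trajectory serves both claims: divergence supplies a time at which the quantity exceeds its
   initial value. *)
have [x [x_traj KL_large]] := lagging_trajectory R hm w L1.
split; exists x; split => //.
  have [T T0 KLT] := KL_large (KLunif m (x 0) + 1).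
  exists 0, T; split => //; split => //.
  by apply: lt_le_trans (KLT T (lexx T)); rewrite ltrDl.
apply/cvgryPge => A; have [T _ KLT] := KL_large A.
by near=> t; apply: KLT; near: t; apply: nbhs_pinfty_ge; exact: num_real.
Unshelve. all: by end_near. Qed.
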